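(* Let $G$ be a Polish group whose universal minimal flow $M(G)$ is metrizable. Then the universal minimal distal flow of $G$ coincides (as a $G$-flow) with the universal minimal equicontinuous flow $B(G)$, and $B(G)=G/H$ for some closed, co-compact subgroup $H$ of $G$. More precisely, writing $M(G)=\widehat{G/G^{*}}$ with $G^{*}$ a closed, co-precompact, extremely amenable subgroup of $G$, one can take $H=(G^{*})^{G}$, where $(G^{*})^{G}$ denotes the closed normal closure of $G^{*}$ in $G$, i.e. $$(G^{*})^{G}=\overline{\Big\langle\bigcup_{g\in G} gG^{*}g^{-1}\Big\rangle}.$$
   Context: A $G$-flow is a continuous action of a topological group $G$ on a (nonempty) compact Hausdorff space $X$; it is minimal when every orbit is dense. A flow maps onto another one when there is a continuous $G$-equivariant surjection from the first to the second. A pair $(x,y)\in X^2$ is proximal when there is a net $(g_\alpha)_\alpha$ in $G$ with $\lim_\alpha g_\alpha\cdot x=\lim_\alpha g_\alpha\cdot y$; it is distal when $x=y$ or $(x,y)$ is not proximal. A flow $X$ is distal when every pair in $X^2$ is distal. It is equicontinuous when for every $x\in X$ and every entourage $\epsilon$ of the uniformity of $X$ there is a neighborhood $U$ of $x$ such that $(g\cdot x,g\cdot y)\in\epsilon$ for all $g\in G$, $y\in U$. For each of the classes of all flows, distal flows, and equicontinuous flows, there is a unique (up to isomorphism) universal minimal object, i.e. a minimal flow in the class that maps onto every minimal flow in the class. These are called respectively the universal minimal flow $M(G)$, the universal minimal distal flow, and the universal minimal equicontinuous flow $B(G)$; the latter is the Bohr compactification of $G$ viewed as a $G$-flow. $G$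 is extremely amenable when every $G$-flow has a fixed point. For a closed subgroup $G^*\leq G$, the space $G/G^{*}$ carries the quotient of the right uniformity of $G$, with basic entourages $\{(xG^*,uxG^* ): x\in G, u\in U\}$ for $U$ a neighborhood of the identity; $\widehat{G/G^{*}}$ is its completion, to which the left translation action of $G$ extends. $G^{*}$ is co-precompact in $G$ when $\widehat{G/G^{*}}$ is compact, and a closed subgroup $H$ is co-compact when $G/H$ is compact. Equalities between flows mean isomorphism of $G$-flows. It is a known result that when $G$ is Polish and $M(G)$ is metrizable, a closed, co-precompact, extremely amenable subgroup $G^*$ with $M(G)=\widehat{G/G^*}$ always exists. *)

(* Defs.v *)
From HB Require Import structures.
From mathcomp Require Import all_boot all_order all_algebra.
From mathcomp Require Import all_classical all_reals topology.

Set Implicit Arguments.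
Unset Strict Implicit.
Unset Printing Implicit Defensive.

Local Open Scope classical_set_scope.
Local Open Scope group_scope.
Local Open Scope quotient_scope.

HB.structure Definition PreTopologicalGroup := {G of Topological G & Group G}.

HB.mixin Record PreTopologicalGroup_isTopologicalGroup G
    & PreTopologicalGroup G := {
  mulg_continuous : continuous (fun p : G * G => p.1 * p.2);
  invg_continuous : continuous (fun x : G => x^-1)
}.

#[short(type="topologicalGroupType")]
HB.structure Definition TopologicalGroup :=
  {G of PreTopologicalGroup G & PreTopologicalGroup_isTopologicalGroup G}.

Definition homeomorphism (X Y : topologicalType) (f : X -> Y) :=
  continuous f /\
  exists g : Y -> X, [/\ continuous g, cancel f g & cancel g f].

Definition complete_uniform (X : uniformType) :=
  forall F : set_system X, ProperFilter F -> cauchy F -> exists x : X, F --> x.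

Definition separable (T : topologicalType) :=
  exists2 D : set T, countable D & dense D.

Definition metrizable (R : realType) (T : topologicalType) :=
  exists (X : metricType R) (f : T -> X), homeomorphism f.

Definition polish (R : realType) (T : topologicalType) :=
  separable T /\
  exists (X : metricType R) (f : T -> X), homeomorphism f /\ complete_uniform X.

Lemma mulgr_continuous (G : topologicalGroupType) (y : G) :
  continuous (fun x : G => x * y).
Proof.
move=> x; apply: (@continuous_comp G (G * G)%type G (fun z => (z, y))
  (fun p => p.1 * p.2)); last exact: mulg_continuous.
exact: (cvg_pair cvg_id (cvg_cst y)).
Qed.

Definition is_subgroup (G : groupType) (A : set G) :=
  [/\ A 1, forall x y, A x -> A y -> A (x * y) & forall x, A x -> A x^-1].

Record subgroup (G : groupType) := Subgroup {
  subgroup_set :> set G;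
  subgroupP : is_subgroup subgroup_set
}.

Definition generated (G : groupType) (A : set G) : set G :=
  smallest (@is_subgroup G) A.

Lemma generated_subgroup (G : groupType) (A : set G) :
  is_subgroup (generated A).
Proof.
split=> [B [[]] //|x y Ax Ay B BA|x Ax B BA]; have [[B1 BM BV] _] := BA.
  by apply: BM; [exact: Ax|exact: Ay].
by apply: BV; exact: Ax.
Qed.

Lemma closure_subgroup (G : topologicalGroupType) (A : set G) :
  is_subgroup A -> is_subgroup (closure A).
Proof.
move=> [A1 AM AV]; split; first exact: subset_closure.
- move=> x y Ax Ay B xyB.
  have [[V W] /= [xV yW] VWB] := @mulg_continuous G (x, y) _ xyB.
  have [a [Aa Va]] := Ax _ xV; have [b [Ab Wb]] := Ay _ yW.
  by exists (a * b); split; [exact: AM|exact: (VWB (a, b))].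
- move=> x Ax B xB.
  have [a [Aa Ba]] := Ax _ (@invg_continuous G x _ xB).
  by exists a^-1; split; [exact: AV|exact: Ba].
Qed.

Definition closed_normal_closure (G : topologicalGroupType) (H : subgroup G) :
    subgroup G :=
  Subgroup (closure_subgroup (generated_subgroup
    (\bigcup_(g in [set: G]) [set g * x * g^-1 | x in subgroup_set H]))).

Definition subgroup_type (G : groupType) (H : subgroup G) : Type :=
  set_type (subgroup_set H).

Section SubgroupType.
Variables (G : topologicalGroupType) (H : subgroup G).
Local Notation HT := (subgroup_type H).

HB.instance Definition _ := Topological.on HT.

Let sub_val (u : HT) : G := set_val u.

Let sub_valP (u : HT) : subgroup_set H (sub_val u).
Proof. by case: u => x xH; exact/set_mem. Qed.

Let sub_mk x (Hx : subgroup_set H x) : HT := exist _ x (mem_set Hx).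

Let sub_val_inj : injective sub_val.
Proof. exact: val_inj. Qed.

Definition subgroup_one : HT :=
  let: And3 H1 _ _ := subgroupP H in sub_mk H1.

Definition subgroup_mul (u v : HT) : HT :=
  let: And3 _ HM _ := subgroupP H in sub_mk (HM _ _ (sub_valP u) (sub_valP v)).

Definition subgroup_inv (u : HT) : HT :=
  let: And3 _ _ HV := subgroupP H in sub_mk (HV _ (sub_valP u)).

Lemma subgroup_val1 : set_val subgroup_one = 1 :> G.
Proof. by rewrite /subgroup_one; case: (subgroupP H). Qed.

Lemma subgroup_valM u v :
  set_val (subgroup_mul u v) = (set_val u : G) * set_val v.
Proof. by rewrite /subgroup_mul; case: (subgroupP H). Qed.

Lemma subgroup_valV u : set_val (subgroup_inv u) = (set_val u : G)^-1.
Proof. by rewrite /subgroup_inv; case: (subgroupP H). Qed.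

Let smulA : associative subgroup_mul.
Proof. by move=> u v w; apply: sub_val_inj; rewrite /sub_val !subgroup_valM mulgA. Qed.
Let smul1 : left_id subgroup_one subgroup_mul.
Proof.
by move=> u; apply: sub_val_inj; rewrite /sub_val subgroup_valM subgroup_val1 mul1g.
Qed.
Let smulr1 : right_id subgroup_one subgroup_mul.
Proof.
by move=> u; apply: sub_val_inj; rewrite /sub_val subgroup_valM subgroup_val1 mulg1.
Qed.
Let smulV : left_inverse subgroup_one subgroup_inv subgroup_mul.
Proof.
move=> u; apply: sub_val_inj.
by rewrite /sub_val subgroup_valM subgroup_valV subgroup_val1 mulVg.
Qed.
Let smulrV : right_inverse subgroup_one subgroup_inv subgroup_mul.
Proof.
move=> u; apply: sub_val_inj.
by rewrite /sub_val subgroup_valM subgroup_valV subgroup_val1 mulgV.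
Qed.

HB.instance Definition _ := isGroup.Build HT smulA smul1 smulr1 smulV smulrV.

Let sub_cvg (T : Type) (F : set_system T) (f : T -> HT) (u : HT) :
  Filter F -> (sub_val \o f) @ F --> sub_val u -> f @ F --> u.
Proof.
move=> FF fu A [_ [[B oB <-] Bu BA]].
apply: filterS; first exact: BA.
by apply: fu; exact: open_nbhs_nbhs.
Qed.

Let sub_val_continuous : continuous sub_val.
Proof. exact: initial_continuous. Qed.

Let smul_continuous : continuous (fun p : HT * HT => p.1 * p.2).
Proof.
move=> [u v]; apply: sub_cvg.
rewrite (_ : _ \o _ = (fun q : G * G => q.1 * q.2) \o
  (fun p : HT * HT => (sub_val p.1, sub_val p.2))); last first.
  by apply/funext => p /=; exact: subgroup_valM.
rewrite (_ : sub_val _ = sub_val u * sub_val v); last exact: subgroup_valM.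
apply: (@continuous_comp (HT * HT)%type (G * G)%type G _ _ (u, v)); last first.
  exact: mulg_continuous.
apply: cvg_pair.
  by apply: (@cvg_comp _ _ _ fst sub_val); [exact: cvg_fst|exact: sub_val_continuous].
by apply: (@cvg_comp _ _ _ snd sub_val); [exact: cvg_snd|exact: sub_val_continuous].
Qed.

Let sinv_continuous : continuous (fun u : HT => u^-1).
Proof.
have valV (v : HT) : sub_val v^-1 = (sub_val v)^-1 by exact: subgroup_valV.
move=> u.
apply: (@sub_cvg _ (nbhs u) (fun v : HT => v^-1) _ (nbhs_filter u)) => A.
rewrite valV => nA.
apply: (@filterS _ _ (nbhs_filter u) _ _ _
  (sub_val_continuous (@invg_continuous G (sub_val u) A nA))) => v.
by rewrite /= valV.
Qed.

HB.instance Definition _ := PreTopologicalGroup_isTopologicalGroup.Build HT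
  smul_continuous sinv_continuous.

End SubgroupType.

Section CosetRel.
Variables (G : groupType) (H : subgroup G).

Definition coset_rel : rel G := fun x y => `[< subgroup_set H (x^-1 * y) >].

Let coset_rel_refl : reflexive coset_rel.
Proof.
by move=> x; apply/asboolP; rewrite mulVg; case: (subgroupP H).
Qed.

Let coset_rel_sym : symmetric coset_rel.
Proof.
move=> x y; apply/asbool_equiv_eq; case: (subgroupP H) => _ _ HV.
by split=> /HV; rewrite invgM invgK.
Qed.

Let coset_rel_trans : transitive coset_rel.
Proof.
move=> y x z /asboolP xy /asboolP yz; apply/asboolP.
case: (subgroupP H) => _ HM _.
by have := HM _ _ xy yz; rewrite -mulgA mulVKg.
Qed.

Canonical coset_equiv := EquivRel coset_rel
  coset_rel_refl coset_rel_sym coset_rel_trans.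

End CosetRel.

(* G/H, the space of left cosets xH with the quotient topology; the class of x
   is \pi_(coset_space H) x. *)
Definition coset_space (G : topologicalGroupType) (H : subgroup G) : Type :=
  quotient_topology {eq_quot (coset_equiv H)}.

Section CosetSpace.
Variables (G : topologicalGroupType) (H : subgroup G).
Local Notation Q := (coset_space H).

HB.instance Definition _ := Topological.on Q.
HB.instance Definition _ := Quotient.on Q.

Lemma coset_eqP (x y : G) :
  \pi_Q x = \pi_Q y <-> subgroup_set H (x^-1 * y).
Proof.
have E : (\pi_Q x = \pi_Q y) =
    (\pi_({eq_quot (coset_equiv H)}) x = \pi_({eq_quot (coset_equiv H)}) y).
  by [].
by rewrite E; split=> [/eqmodP/asboolP|xy] //; apply/eqmodP/asboolP.
Qed.

Lemma coset_mull (g x y : G) :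
  \pi_Q x = \pi_Q y -> \pi_Q (g * x) = \pi_Q (g * y).
Proof. by move=> /coset_eqP xy; apply/coset_eqP; rewrite invgM -mulgA mulKg. Qed.

Lemma coset_pi_continuous : continuous (\pi_Q : G -> Q).
Proof. exact: (@pi_continuous G {eq_quot (coset_equiv H)}). Qed.

Lemma coset_pi_open (A : set G) : open A -> open (\pi_Q @` A : set Q).
Proof.
move=> oA; rewrite /open /= /quotient_open.
rewrite (_ : _ @^-1` _ =
    \bigcup_(h in subgroup_set H) ((fun x : G => x * h) @^-1` A)).
  apply: bigcup_open => h _; apply: open_comp => // x _.
  exact: mulgr_continuous.
apply/seteqP; split=> x /=.
  move=> [a Aa] ax; exists (x^-1 * a); last by rewrite /= mulVKg.
  by apply/coset_eqP; apply/esym.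
move=> [h Hh Axh]; exists (x * h) => //; apply/esym/coset_eqP.
by rewrite mulKg.
Qed.

Lemma coset_pi_nbhs (x : G) (A : set G) :
  nbhs x A -> nbhs (\pi_Q x) (\pi_Q @` A : set Q).
Proof.
rewrite nbhsE => -[B [oB Bx] BA]; rewrite nbhsE.
exists (\pi_Q @` B); last by move=> _ [b Bb <-]; exists b => //; exact: BA.
by split; [exact: coset_pi_open|exists x].
Qed.

Lemma cosetW (q : Q) : exists x, q = \pi_Q x.
Proof. by exists (repr q); rewrite reprK. Qed.

(* The quotient of the right uniformity of G, generated by the sets
   {(xH, uxH) : x in G, u in U} for U a neighborhood of 1. *)
Definition coset_entourage : set_system (Q * Q) :=
  filter_from (nbhs (1 : G))
    (fun U => [set (\pi_Q x, \pi_Q (u * x)) | x in [set: G] & u in U]).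

Let coset_ent_filter : Filter coset_entourage.
Proof.
apply: filter_from_filter; first by exists setT; exact: filterT.
move=> U V nU nV; exists (U `&` V); first exact: filterI.
by move=> _ [x _ [u [Uu Vu] <-]]; split; exists x => //; exists u.
Qed.

Let coset_ent_diag A : coset_entourage A -> diagonal `<=` A.
Proof.
move=> [U nU UA] [p q] /diagonalP <-; apply: UA.
have [x ->] := cosetW p; exists x => //; exists 1; first exact: nbhs_singleton.
by rewrite mul1g.
Qed.

Let coset_ent_inv A : coset_entourage A -> coset_entourage (A^-1)%relation.
Proof.
move=> [U nU UA]; exists ((fun x : G => x^-1) @^-1` U).
  by apply: invg_continuous; rewrite invg1.
move=> _ [x _ [u Uu <-]]; apply: UA; exists (u * x) => //.
by exists u^-1; rewrite // mulKg.
Qed.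

Let coset_ent_split A : coset_entourage A ->
  exists2 B, coset_entourage B & (B \; B)%relation `<=` A.
Proof.
move=> [U nU UA].
have [[V W] /= [nV nW] VWU] : nbhs ((1, 1) : G * G)
    ((fun p : G * G => p.1 * p.2) @^-1` U).
  by apply: mulg_continuous; rewrite mul1g.
pose Z := V `&` W.
exists [set (\pi_Q x, \pi_Q (u * x)) | x in [set: G] & u in Z].
  by exists Z => //; exact: filterI.
move=> [p q] [r [x _ [u [Vu Wu] [<- <-]]] [y _ [v [Vv Wv] [yux <-]]]].
apply: UA; exists x => //; exists (v * u); first exact: (VWU (v, u)).
by congr (_, _); rewrite -mulgA; apply/coset_mull/esym.
Qed.

Let coset_nbhsE : nbhs = nbhs_ coset_entourage.
Proof.
apply/funext => q; have [x ->] := cosetW q; apply/seteqP; split=> A.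
  move=> nA; exists [set (\pi_Q y, \pi_Q (u * y)) | y in [set: G] &
      u in [set u | A (\pi_Q (u * x))]].
    exists [set u | A (\pi_Q (u * x))] => //.
    have nA' : nbhs (1 * x) (\pi_Q @^-1` A).
      by rewrite mul1g; exact: coset_pi_continuous.
    exact: mulgr_continuous nA'.
  move=> p /xsectionP [y _ [u Au [yx <-]]].
  by rewrite (coset_mull u yx).
move=> [B [U nU UB] BA].
suff: nbhs (\pi_Q x) (\pi_Q @` ((fun y : G => y * x^-1) @^-1` U) : set Q).
  apply: filterS => _ [y Uy <-]; apply: BA; apply/xsectionP/UB.
  by exists x => //; exists (y * x^-1) => //; rewrite mulgVK.
apply: coset_pi_nbhs; apply: mulgr_continuous; by rewrite mulgV.
Qed.

HB.instance Definition _ := Nbhs_isUniform_mixin.Build Q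
  coset_ent_filter coset_ent_diag coset_ent_inv coset_ent_split coset_nbhsE.

End CosetSpace.

Record gspace (G : topologicalGroupType) := GSpace {
  gspace_sort :> uniformType;
  gact : G -> gspace_sort -> gspace_sort;
  gact1 : forall x, gact 1 x = x;
  gactM : forall g h x, gact (g * h) x = gact g (gact h x);
  gact_continuous : continuous (fun p : G * gspace_sort => gact p.1 p.2)
}.

(* A compact Hausdorff topology is induced by exactly one uniformity, so the
   uniform structure of the carrier adds no data. *)
Record flow (G : topologicalGroupType) := Flow {
  flow_gspace :> gspace G;
  flow_nonempty : [set: flow_gspace] !=set0;
  flow_compact : compact [set: flow_gspace];
  flow_hausdorff : hausdorff_space flow_gspace
}.

Section CosetAction.
Variables (G : topologicalGroupType) (H : subgroup G).
Local Notation Q := (coset_space H).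

Definition coset_act (g : G) (q : Q) : Q := \pi_Q (g * repr q).

Lemma coset_actE g x : coset_act g (\pi_Q x) = \pi_Q (g * x).
Proof. by apply: coset_mull; rewrite reprK. Qed.

Let coset_act1 q : coset_act 1 q = q.
Proof. by have [x ->] := cosetW q; rewrite coset_actE mul1g. Qed.

Let coset_actM g h q : coset_act (g * h) q = coset_act g (coset_act h q).
Proof. by have [x ->] := cosetW q; rewrite !coset_actE mulgA. Qed.

Let coset_act_continuous : continuous (fun p : G * Q => coset_act p.1 p.2).
Proof.
move=> [g q]; have [x ->] := cosetW q => A; rewrite /= coset_actE => nA.
have nA' : nbhs (g * x) (\pi_Q @^-1` A) by exact: coset_pi_continuous.
have := @mulg_continuous G (g, x) _ nA'.
move=> [[V W] /= [nV nW] VWA]; exists (V, \pi_Q @` W).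
  by split=> //; exact: coset_pi_nbhs.
move=> [h _] [/= Vh [y Wy <-]]; rewrite coset_actE; exact: (VWA (h, y)).
Qed.

Definition coset_gspace : gspace G :=
  GSpace coset_act1 coset_actM coset_act_continuous.

End CosetAction.

Section Flows.
Variable G : topologicalGroupType.
Implicit Types X Y : gspace G.

Definition equivariant X Y (f : X -> Y) :=
  forall g x, f (gact g x) = gact g (f x).

Definition gspace_iso X Y :=
  exists f : X -> Y, homeomorphism f /\ equivariant f.

Definition maps_onto X Y :=
  exists f : X -> Y,
    [/\ continuous f, equivariant f & range f = [set: Y]].

Definition orbit X (x : X) : set X := range (fun g : G => gact g x).

Definition minimal X := forall x : X, dense (orbit x).

(* Convergence along a net in G is convergence along its tail filter, and every
   proper filter on G is the tail filter of a net. *)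
Definition proximal X (x y : X) :=
  exists F : set_system G, ProperFilter F /\
    exists z : X, gact g x @[g --> F] --> z /\ gact g y @[g --> F] --> z.

Definition distal_pair X (x y : X) := x = y \/ ~ proximal x y.

Definition distal X := forall x y : X, distal_pair x y.

Definition equicontinuous_action X :=
  forall (x : X) (E : set (X * X)), entourage E ->
    exists2 U, nbhs x U & forall g y, U y -> E (gact g x, gact g y).

Definition universal_minimal (P : flow G -> Prop) (X : flow G) :=
  [/\ P X, minimal X & forall Y : flow G, P Y -> minimal Y -> maps_onto X Y].

Definition universal_minimal_flow := universal_minimal (fun=> True).

Definition universal_minimal_distal_flow := universal_minimal (fun X : flow G => distal X).

Definition universal_minimal_equicontinuous_flow :=
  universal_minimal (fun X : flow G => equicontinuous_action X).

Definition extremely_amenable :=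
  forall X : flow G, exists x : X, forall g, gact g x = x.

End Flows.

(* The Hausdorff completion, up to isomorphism: a complete Hausdorff space C and
   a map with dense range along which X carries the initial uniformity. *)
Definition is_completion (X C : uniformType) (j : X -> C) :=
  [/\ hausdorff_space C, complete_uniform C, dense (range j) &
      forall E : set (X * X), entourage E <->
        exists2 D : set (C * C), entourage D &
          [set p | D (j p.1, j p.2)] `<=` E].

Definition coprecompact (G : topologicalGroupType) (H : subgroup G) :=
  exists (C : uniformType) (j : coset_space H -> C),
    is_completion j /\ compact [set: C].

(* X is a completion of G/H, and the action on X extends the left translations
   of G/H; by density of G/H such an extension is unique. *)
Definition is_coset_completion (G : topologicalGroupType) (H : subgroup G)
    (X : gspace G) :=
  exists j : coset_gspace H -> X, is_completion j /\ equivariant j.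

Definition cocompact (G : topologicalGroupType) (H : subgroup G) :=
  compact [set: coset_space H].

(* Main.v *)
Require Import Defs.
From mathcomp Require Import all_boot all_order all_algebra.
From mathcomp Require Import all_classical all_reals topology.
From HB Require Import structures.
From mathcomp Require Import normedtype ereal lra.
Import Defs.

(* A distal flow D has an Ellis group K, the pointwise closure of G in D -> D;
   it is a compact group in which right translations are continuous, and K is
   again a minimal distal flow. As a factor of the metrizable flow M it has a
   countable base, so every left translation is a pointwise limit of a sequence
   of elements of G. Baire's theorem gives it a point of continuity, hence makes
   it continuous, and a second use of Baire's theorem makes K a topological group.
   Thus K is equicontinuous.

   Metrizability of M also forces G -> K to be almost open. Otherwise there are a
   neighborhood U of 1 and open sets O_n in K such that U O_n misses O_k whenever
   n <> k. Every set S of integers then gives a right uniformly continuous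
   function on G that is 0 on the elements sending the base point into O_n for
   n in S and 1 on those sending it into O_n for n outside S. A minimal flow on
   which all these functions extend continuously is a factor of M, and would need
   uncountably many open sets. As G is Polish, an almost open homomorphism to K
   is open and onto. So K = G/H for the stabilizer H of the identity, and a
   minimal flow that is both a factor and an extension of K is isomorphic to K;
   this applies to D and to B.

   An extremely amenable G* fixes a point of K, hence lies in H, and so does its
   closed normal closure N. Conversely, since G/G* is precompact, right uniformly
   continuous functions on G/N are almost periodic, so an element outside N moves
   a point of a minimal equicontinuous flow, and is not in H. *)

Set Implicit Arguments.
Unset Strict Implicit.
Unset Printing Implicit Defensive.

Import Order.TTheory GRing.Theory Num.Theory.
Import numFieldNormedType.Exports.

Local Open Scope classical_set_scope.
Local Open Scope group_scope.

(** * Topology *)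

Lemma compact_directed_cap (T : topologicalType) (F : set (set T)) :
  compact [set: T] -> F !=set0 ->
  (forall A, F A -> closed A /\ A !=set0) ->
  (forall A B, F A -> F B -> exists2 C, F C & C `<=` A `&` B) ->
  \bigcap_(A in F) A !=set0.
Proof.
move=> cT [A0 FA0] FP FD.
have FF : ProperFilter (filter_from F id).
  apply: filter_from_proper; last by move=> A /FP[].
  apply: filter_from_filter; first by exists A0.
  by move=> A B FA FB; have [C FC CAB] := FD _ _ FA FB; exists C.
have [|p [_ clp]] := cT _ FF; first by exists A0.
exists p => A FA; apply: (FP _ FA).1 => B pB.
by apply: clp => //; exists A.
Qed.

(** Zorn's lemma is applied to complements in [A0], so that a chain is bounded by its union;
    compactness keeps the corresponding intersection nonempty. It serves for minimal subflows and
    for minimal closed semigroups. *)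
Lemma exists_minimal_closed (T : topologicalType) (P : set T -> Prop)
    (A0 : set T) :
  compact [set: T] -> (forall A, P A -> closed A) ->
  (forall F : set (set T), F `<=` P -> P (\bigcap_(A in F) A)) ->
  P A0 -> A0 !=set0 ->
  exists A, [/\ A `<=` A0, P A, A !=set0 &
    forall B, P B -> B !=set0 -> B `<=` A -> B = A].
Proof.
move=> cT Pc Pcap PA0 A0n.
pose Q : set (set T) := [set C | P (A0 `\` C) /\ A0 `\` C !=set0].
have [|C [[PC Cn] Cmax]] := @Zorn_bigcup T Q.
  move=> F FQ Ft; have [F0|/set0P [C0 FC0]] := eqVneq F set0.
    by rewrite F0 bigcup_set0; split; rewrite setD0.
  have E : A0 `\` \bigcup_(X in F) X = \bigcap_(A in [set A0 `\` X | X in F]) A.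
    apply/seteqP; split=> [x [Ax Fx] _ [X FX <-]|x Fx].
      by split=> // Xx; apply: Fx; exists X.
    have [A0x _] : (A0 `\` C0) x by apply: Fx; exists C0.
    split=> // -[X FX Xx].
    by have [] : (A0 `\` X) x by apply: Fx; exists X.
  rewrite /Q /= E; split.
    by apply: Pcap => _ [X FX <-]; exact: (FQ _ FX).1.
  apply: compact_directed_cap => //.
  - by exists (A0 `\` C0), C0.
  - by move=> _ [X FX <-]; have [/Pc ? ?] := FQ _ FX.
  - move=> _ _ [X FX <-] [Y FY <-]; have [XY|YX] := Ft _ _ FX FY.
      exists (A0 `\` Y); first by exists Y.
      by move=> x [Ax Yx]; split; split=> // /XY.
    exists (A0 `\` X); first by exists X.
    by move=> x [Ax Xx]; split; split=> // /YX.
exists (A0 `\` C); split=> // B PB Bn BA.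
apply/seteqP; split=> // x [A0x Cx]; apply/not_notP => Bx.
have E : A0 `\` ~` B = B.
  apply/seteqP; split=> [y [_ nBy]|y yB]; first exact: contrapT.
  by have [Ay _] := BA _ yB; split=> // nB; exact: nB.
apply: (Cmax (~` B)); last by rewrite /Q /= E.
split=> [y Cy By|BC]; first by case: (BA _ By).
by apply: Cx; exact: BC.
Qed.

Lemma closed_map (X Y : topologicalType) (f : X -> Y) (A : set X) :
  compact [set: X] -> hausdorff_space Y -> continuous f ->
  closed A -> closed (f @` A).
Proof.
move=> cX hY cf cA; apply: compact_closed => //.
apply: continuous_compact; first exact: continuous_subspaceT.
exact: subclosed_compact cA cX _.
Qed.

Lemma continuous_bij_homeo (X Y : topologicalType) (f : X -> Y) :
  compact [set: X] -> hausdorff_space Y -> continuous f ->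
  injective f -> range f = [set: Y] -> homeomorphism f.
Proof.
move=> cX hY cf injf surf; split => //.
have /choice [g fg] : forall y, exists x, f x = y.
  by move=> y; have [x _ <-] : range f y by [rewrite surf]; exists x.
have gf : cancel f g by move=> x; apply: injf.
exists g; split=> //; apply/continuous_closedP => A cA.
rewrite (_ : _ @^-1` _ = f @` A); first exact: closed_map.
by apply/seteqP; split=> [y Ay|_ [x Ax <-]]; [exists (g y)|rewrite /= gf].
Qed.

Lemma homeomorphism_inv (X Y : topologicalType) (f : X -> Y) :
  homeomorphism f ->
  exists g : Y -> X, [/\ homeomorphism g, cancel f g & cancel g f].
Proof.
by move=> [cf [g [cg fg gf]]]; exists g; split=> //; split=> //; exists f.
Qed.

Lemma compact_regular_space (T : topologicalType) :
  compact [set: T] -> hausdorff_space T -> regular_space T.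
Proof.
by move=> cT hT x; apply: (compact_regular hT cT); exact: filterT.
Qed.

Lemma regular_open (T : topologicalType) (x : T) (A : set T) :
  regular_space T -> nbhs x A ->
  exists B, [/\ open B, B x & closure B `<=` A].
Proof.
move=> rT /rT [B nB BA]; exists B°; split; first exact: open_interior.
  exact: nbhs_singleton (nbhs_interior nB).
by apply: subset_trans BA; apply: closureS; exact: interior_subset.
Qed.

(** A form of Baire's theorem: the boundaries of countably many closed sets do not cover [O]. An
    open set is shrunk, with nested closures, so that at stage [n] it lies inside [C n] or misses
    it; compactness gives a common point. *)
Lemma baire_closed (T : topologicalType) (C : nat -> set T) (O : set T) :
  compact [set: T] -> hausdorff_space T ->
  (forall n, closed (C n)) -> open O -> O !=set0 ->
  exists2 x, O x & forall n, C n x -> (C n)° x.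
Proof.
move=> cT hT cC oO [x0 Ox0].
have rT := compact_regular_space cT hT.
pose st := {A : set T | open A /\ A !=set0}.
have step (n : nat) (A : st) : exists B : st, closure (sval B) `<=` sval A /\
    (sval B `<=` C n \/ sval B `<=` ~` C n).
  case: A => A [oA [a Aa]].
  have [AC|/existsNP [b /not_implyP [Ab Cb]]] := pselect (A `<=` C n).
    have [B [oB Ba BA]] := regular_open rT (open_nbhs_nbhs (conj oA Aa)).
    have Bn : B !=set0 by exists a.
    exists (exist _ B (conj oB Bn)); split=> //=; left.
    by apply: subset_trans AC; apply: subset_trans BA; exact: subset_closure.
  have nAC : nbhs b (A `&` ~` C n).
    apply: filterI; apply: open_nbhs_nbhs; split=> //.
    exact: closed_openC.
  have [B [oB Ba BA]] := regular_open rT nAC.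
  have Bn : B !=set0 by exists b.
  exists (exist _ B (conj oB Bn)); split=> /=; first by move=> y /BA [].
  by right=> y By; have [] := BA _ (subset_closure By).
have [f fP] : exists f : nat -> st -> st, forall n A,
    closure (sval (f n A)) `<=` sval A /\
    (sval (f n A) `<=` C n \/ sval (f n A) `<=` ~` C n).
  have /choice [f fP] : forall nA : nat * st, exists B : st,
      closure (sval B) `<=` sval nA.2 /\
      (sval B `<=` C nA.1 \/ sval B `<=` ~` C nA.1) by case.
  by exists (fun n A => f (n, A)) => n A; exact: (fP (n, A)).
have On : O !=set0 by exists x0.
pose s := fix s n : st :=
  if n is m.+1 then f m (s m) else exist _ O (conj oO On).
have sS n : closure (sval (s n.+1)) `<=` sval (s n) by exact: (fP _ _).1.
have sD m n : (m <= n)%N -> sval (s n) `<=` sval (s m).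
  elim: n => [|n IH]; first by rewrite leqn0 => /eqP ->.
  rewrite leq_eqVlt => /predU1P[<-//|/ltnSE/IH]; apply: subset_trans.
  by apply: subset_trans (sS n); exact: subset_closure.
have [x xP] : \bigcap_(A in range (fun n => closure (sval (s n)))) A !=set0.
  apply: compact_directed_cap => //.
    by exists (closure (sval (s 0%N))), 0%N.
    move=> _ [n _ <-]; split; first exact: closed_closure.
    by case: (svalP (s n)) => _ [y sy]; exists y; exact: subset_closure.
  move=> _ _ [m _ <-] [n _ <-]; exists (closure (sval (s (maxn m n)))).
    by exists (maxn m n).
  by rewrite subsetI; split; apply/closureS/sD; rewrite ?leq_maxl ?leq_maxr.
have {}xP n : sval (s n) x.
  by apply: sS; apply: xP; exists n.+1.
exists x; first exact: (xP 0%N).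
move=> n Cx; have [sC|sC] := (fP n (s n)).2.
  apply: (interiorS sC); apply: open_nbhs_nbhs; split; last exact: (xP n.+1).
  by case: (svalP (s n.+1)).
by have := sC _ (xP n.+1).
Qed.

(* The sets [P n] approximate all closed sets, not only points: in this form the
   property passes to quotients. *)
Definition countably_based (T : topologicalType) := exists P : nat -> set T,
  (forall n, open (P n)) /\
  forall C O : set T, closed C -> open O -> C `<=` O ->
    exists n, C `<=` P n /\ P n `<=` O.

(** The image of [P n] need not be open, so it is replaced by the set of points whose whole fibre
    lies in [P n]. *)
Lemma countably_based_image (X Y : topologicalType) (f : X -> Y) :
  compact [set: X] -> hausdorff_space Y -> continuous f ->
  range f = [set: Y] -> countably_based X -> countably_based Y.
Proof.
move=> cX hY cf sf [P [oP PP]]; exists (fun n => ~` (f @` (~` P n))).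
split=> [n|C O cC oO CO].
  by apply: closed_openC; apply: closed_map => //; exact: open_closedC.
have [|||n [Cn On]] := PP (f @^-1` C) (f @^-1` O).
- by have /continuous_closedP := cf; exact.
- by have /continuousP := cf; exact.
- by move=> x /CO.
exists n; split=> [y Cy [x nx xy]|y ny].
  by apply: nx; apply: Cn; rewrite /= xy.
have [x _ xy] : range f y by rewrite sf.
by rewrite -xy; apply: On; apply/not_notP => nx; apply: ny; exists x.
Qed.

Lemma compact_finite_cover (T : topologicalType) (I : choiceType) (D : set I)
    (f : I -> set T) :
  compact [set: T] -> (forall i, D i -> open (f i)) ->
  (forall x, exists2 i, D i & f i x) ->
  exists2 s : seq I, (forall i, i \in s -> D i) &
    forall x, exists2 i, i \in s & f i x.
Proof.
move=> cT of_ cov; have [[x0]|Te] := pselect ([set: T] !=set0); last first.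
  by exists [::] => // x; case: Te; exists x.
pose pT : ptopologicalType := HB.pack T (isPointed.Build T x0).
have : @compact pT setT := cT.
rewrite compact_cover => /(_ I D f of_)[|s sD sP].
  by move=> x _; have [i Di fi] := cov x; exists i.
exists (finmap.enum_fset s) => [i si|x]; first by apply/set_mem/sD.
by have [i /= si fi] := sP x Logic.I; exists i.
Qed.

Lemma compact_nat_cover (T : topologicalType) (C : set T) (D : set nat)
    (f : nat -> set T) :
  compact C -> (forall n, D n -> open (f n)) ->
  (forall x, C x -> exists2 n, D n & f n x) ->
  exists n, forall x, C x -> exists2 i, (i <= n)%N /\ D i & f i x.
Proof.
move=> /compact_near_coveringP cC of_ cov.
have [|n _ nP] := cC nat \oo
    (fun n x => exists2 i, (i <= n)%N /\ D i & f i x) _.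
  move=> x /cov [i Di fi].
  exists (f i, [set n | (i <= n)%N]).
    by split; [apply: open_nbhs_nbhs; split=> //; exact: of_|exists i].
  by move=> [y n] /= [fy ni]; exists i.
by exists n; exact: (nP n (leqnn n)).
Qed.

(** Finite unions of members of a countable base suffice, because the closed set to be enclosed is
    compact. *)
Lemma metrizable_countably_based (R : realType) (T : topologicalType) :
  compact [set: T] -> [set: T] !=set0 -> metrizable R T -> countably_based T.
Proof.
move=> cT [t0 _] [X [f hf]]; have [g [hg fg gf]] := homeomorphism_inv hf.
have cX : compact [set: X].
  rewrite (_ : setT = range f); last first.
    by apply/seteqP; split=> // x _; exists (g x).
  by apply: continuous_compact => //; apply: continuous_subspaceT; exact: hf.1.
pose pX : pseudoPMetricType R := HB.pack X (isPointed.Build X (f t0)).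
have [B cB [oB BP]] := @compact_second_countable R pX cX.
have [h hinj] := countable_injP _ cB.
(* An index that [h] takes at no member of [B] gives the empty set. *)
pose b n : set T := f @^-1` (\bigcup_(V in [set V | B V /\ h V = n]) V).
have ob n : open (b n).
  have /continuousP := hf.1; apply.
  by apply: bigcup_open => V [/oB].
have bP (x : T) (O : set T) : open O -> O x -> exists2 n, b n x & b n `<=` O.
  move=> oO Ox; have gO : nbhs (f x) (g @^-1` O).
    by apply: hg.1; rewrite fg; exact: open_nbhs_nbhs.
  have [V [BV Vx] VO] := BP _ _ gO; exists (h V); first by exists V.
  move=> y [W [BW hW] Wy]; rewrite -(fg y); apply: VO.
  by have <- // : W = V; apply: hinj => //; exact/mem_set.
pose U (s : seq nat) := \bigcup_(i in [set i | i \in s]) b i.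
(* The integer [n] is read as the code of a finite list of indices; a non-code stands for the empty
   list. *)
exists (fun n => U (odflt [::] (unpickle n))).
split=> [n|C O cC oO CO].
  by apply: bigcup_open => i _; exact: ob.
have compC : compact C by exact: subclosed_compact cC cT _.
have [||N NP] := @compact_nat_cover T C [set n | b n `<=` O] b compC.
  by move=> n _; exact: ob.
  by move=> x /CO Ox; have [n bn nO] := bP _ _ oO Ox; exists n.
pose s := [seq i <- iota 0 N.+1 | `[< b i `<=` O >]].
have sE i : (i \in s) = `[< b i `<=` O >] && (i <= N)%N.
  by rewrite mem_filter mem_iota add0n ltnS.
exists (pickle s); rewrite pickleK; split=> [x /NP [i [iN iO] bx]|x [i]].
  by exists i => //; rewrite /= sE iN andbT; exact/asboolP.
by rewrite /= sE => /andP[/asboolP bO _]; exact: bO.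
Qed.

Lemma baire_closed_count (I : countType) (T : topologicalType)
    (C : I -> set T) (O : set T) :
  compact [set: T] -> hausdorff_space T ->
  (forall i, closed (C i)) -> open O -> O !=set0 ->
  exists2 x, O x & forall i, C i x -> (C i)° x.
Proof.
move=> cT hT cC oO On.
have [|x Ox xC] := @baire_closed T
    (fun n => if unpickle n is Some i then C i else set0) O cT hT _ oO On.
  by move=> n; case: unpickle => [i|]; [exact: cC|exact: closed0].
by exists x => // i; have := xC (pickle i); rewrite pickleK.
Qed.

Lemma based_nbhs (T : topologicalType) (P : nat -> set T) (x : T) (A : set T) :
  compact [set: T] -> hausdorff_space T ->
  (forall C O : set T, closed C -> open O -> C `<=` O ->
    exists n, C `<=` P n /\ P n `<=` O) ->
  nbhs x A -> exists2 n, P n x & closure (P n) `<=` A.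
Proof.
move=> cT hT PP nA.
have [B [oB Bx BA]] := regular_open (compact_regular_space cT hT) nA.
have [||n [xn nB]] := PP [set x] B _ oB.
- by apply: accessible_closed_set1; exact: hausdorff_accessible.
- by move=> _ ->.
exists n; first exact: xn.
by apply: subset_trans BA; exact: closureS.
Qed.

Lemma finite_near (T : eqType) (X : topologicalType) (x : X) (s : seq T)
    (P : T -> set X) :
  (forall t, t \in s -> nbhs x (P t)) ->
  nbhs x [set y | forall t, t \in s -> P t y].
Proof.
elim: s => [|t s IH] sP; first by apply: filterE => y t.
have nt : nbhs x (P t) by apply: sP; rewrite mem_head.
have ns : nbhs x [set y | forall t, t \in s -> P t y].
  by apply: IH => t' t's; apply: sP; rewrite inE t's orbT.
apply: filterS (filterI nt ns) => y [Pt Ps] t'.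
by rewrite inE => /predU1P[->|]; [exact: Pt|exact: Ps].
Qed.

Lemma pair_hausdorff (U V : topologicalType) :
  hausdorff_space U -> hausdorff_space V -> hausdorff_space (U * V)%type.
Proof.
move=> hU hV [a b] [c d] cl; congr (_, _).
- apply: hU => A B nA nB.
  have [||[x y] [/= Ax Bx]] := cl (fst @^-1` A) (fst @^-1` B).
  + exact: (@cvg_fst _ _ (nbhs a) (nbhs b)) nA.
  + exact: (@cvg_fst _ _ (nbhs c) (nbhs d)) nB.
  by exists x.
- apply: hV => A B nA nB.
  have [||[x y] [/= Ax Bx]] := cl (snd @^-1` A) (snd @^-1` B).
  + exact: (@cvg_snd _ _ (nbhs a) (nbhs b)) nA.
  + exact: (@cvg_snd _ _ (nbhs c) (nbhs d)) nB.
  by exists y.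
Qed.

(** * Pointwise convergence *)

Section Ptws.
Variables (I : eqType) (V : topologicalType).
Implicit Types (p : {ptws I -> V}).

Lemma eval_continuous (i : I) : continuous (fun f : {ptws I -> V} => f i).
Proof. exact: (@proj_continuous I (fun=> V) i). Qed.

Lemma ptws_cvg (X : Type) (F : set_system X) (f : X -> {ptws I -> V}) p :
  Filter F -> (forall i, f y i @[y --> F] --> p i) -> f @ F --> p.
Proof.
move=> FF cf; apply/cvg_sup => i A [_ [[B oB <-] Bp] BA].
have nB : nbhs (p i) B by exact: open_nbhs_nbhs.
by have := cf i B nB; apply: (@filterS _ F) => y By; exact: BA.
Qed.

Lemma ptws_continuous (X : topologicalType) (f : X -> {ptws I -> V}) (x : X) :
  (forall i, {for x, continuous (fun y => f y i)}) -> {for x, continuous f}.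
Proof. by move=> cf; exact: ptws_cvg. Qed.

Lemma ptws_hausdorff : hausdorff_space V -> hausdorff_space {ptws I -> V}.
Proof. by move=> hV; exact: (@hausdorff_product I (fun=> V)). Qed.

Lemma ptws_compact (A : set V) : compact A ->
  compact [set f : {ptws I -> V} | forall i, A (f i)].
Proof. by move=> cA; exact: (@tychonoff I (fun=> V) (fun=> A)). Qed.

End Ptws.

Lemma countable_enumeration (T : Type) (D : set T) :
  countable D -> D !=set0 -> exists d : nat -> T, D `<=` range d.
Proof.
move=> /countable_injP [h hinj] [x0 Dx0].
have /choice [d dP] : forall k, exists x, forall y, D y -> h y = k -> x = y.
  move=> k; have [[x [Dx xk]]|no] := pselect (exists x, D x /\ h x = k).
    by exists x => y Dy yk; apply: hinj; rewrite ?inE// yk.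
  by exists x0 => y Dy yk; case: no; exists y.
by exists d => y Dy; exists (h y) => //; exact: dP.
Qed.

(** * Almost open maps on Polish spaces *)

Section AlmostOpen.
Local Open Scope ring_scope.

(** The base consists of the interiors of preimages of balls of radii [1 / (k + 1)] around a dense
    sequence. The closure and diameter clauses allow nested sequences of base sets to be Cauchy. *)
Lemma separable_metric_base (R : realType) (X : topologicalType)
    (Y : metricType R) (f : X -> Y) :
  separable X -> X -> homeomorphism f ->
  exists B : nat * nat -> set X, (forall i, open (B i)) /\
    forall x A (n : nat), nbhs x A ->
      exists i, [/\ B i x, closure (B i) `<=` A & forall a b,
        B i a -> B i b -> ball (f a) n.+1%:R^-1 (f b)].
Proof.
move=> [D cD dD] x0 hf; have [h [hh fh hf']] := homeomorphism_inv hf.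
have Dn : D !=set0.
  by have [|z [_ Dz]] := dD setT _ openT; [exists x0|exists z].
have [d Dd] := countable_enumeration cD Dn.
pose r n : R := n.+1%:R^-1.
have r0 n : 0 < r n by rewrite invr_gt0.
have rlt (e : R) : 0 < e -> exists n, r n < e.
  move=> e0; have [k] := @ltr_add_invr R 0 e e0.
  by rewrite add0r; exists k.
exists (fun i => (f @^-1` ball (f (d i.1)) (r i.2))°); split.
  by move=> i; exact: open_interior.
move=> x A n nA.
have nA' : nbhs (f x) (h @^-1` A) by apply: hh.1; rewrite fh.
have /nbhs_ballP [e /= e0 eA] := nA'.
(* The bound [r n / 2] controls the diameter [2 r k]; the bound [e / 3] is used for the closure,
   whose points are within [5/2 r k] of [x]. *)
have [k] : exists k, r k < Num.min (r n / 2) (e / 3).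
  by apply: rlt; rewrite lt_min !divr_gt0.
rewrite lt_min => /andP[kn ke].
pose O := (f @^-1` ball (f x) (r k / 2))°.
have Ox : O x.
  apply: nbhs_singleton; apply: nbhs_interior; apply: hf.1.
  by apply: nbhsx_ballx; rewrite divr_gt0.
have [z [Oz Dz]] := dD O (ex_intro _ x Ox) (open_interior _).
have [l _ lz] := Dd _ Dz.
have {Oz} xz : ball (f x) (r k / 2) (f z) by exact: interior_subset Oz.
have Bs a : (f @^-1` ball (f (d l)) (r k))° a -> ball (f z) (r k) (f a).
  by move=> /interior_subset /=; rewrite lz.
exists (l, k); split => /=.
- apply: (@filterS _ (nbhs x) _ (f @^-1` ball (f x) (r k / 2))).
    move=> a /= xa; rewrite lz (splitr (r k)); apply: ball_triangle xa.
    exact: ball_sym.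
  by apply: hf.1; apply: nbhsx_ballx; rewrite divr_gt0.
- move=> y cy.
  have ny : nbhs y (f @^-1` ball (f y) (r k)).
    by apply: hf.1; exact: nbhsx_ballx.
  have [b [/Bs zb yb]] := cy _ ny.
  suff : (h @^-1` A) (f y) by rewrite /= fh.
  apply: eA; apply: (@le_ball _ _ _ (r k / 2 + r k + r k)).
    by have := r0 k; lra.
  exact: ball_triangle (ball_triangle xz zb) (ball_sym yb).
- move=> a b /Bs za /Bs zb; apply: (@le_ball _ _ _ (r k + r k)).
    by rewrite -/(r n); lra.
  exact: ball_triangle (ball_sym za) zb.
Qed.

(** [C (k, n)] holds the points of the closure of [f (B k)] that are interior to the closure of no
    [f (B l)] with [B l] finer; almost openness makes it nowhere dense. A point outside all these
    sets and close to [f x] lies in the closures of the images of ever finer base sets, and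
    completeness turns their common point into a preimage. *)
Lemma almost_open_comeagre (R : realType) (X K : topologicalType) (f : X -> K) :
  polish R X -> X -> hausdorff_space K -> continuous f ->
  (forall x U, nbhs x U -> nbhs (f x) (closure (f @` U))) ->
  exists C : nat * nat * nat -> set K, [/\ forall i, closed (C i),
    forall i, (C i)° = set0 & forall x V, nbhs x V ->
      nbhs (f x) [set y | (forall i, ~ C i y) -> (f @` V) y]].
Proof.
move=> [sX [Y [h [hh cY]]]] x0 hK cf aof.
have [h' [hh' hK' h'K]] := homeomorphism_inv hh.
have [B [oB BP]] := separable_metric_base sX x0 hh.
pose finer (n : nat) (k l : nat * nat) := closure (B l) `<=` B k /\
  forall a b, B l a -> B l b -> ball (h a) n.+1%:R^-1 (h b).
pose O k n := \bigcup_(l in [set l | finer n k l]) (closure (f @` B l))°.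
pose C i := closure (f @` B i.1) `\` O i.1 i.2.
exists C; split=> [i|[k n]|x V nV].
- apply: closedI; first exact: closed_closure.
  by apply: open_closedC; apply: bigcup_open => l _; exact: open_interior.
- rewrite -subset0 => y /= Cy.
  have [Ccl _] := interior_subset Cy.
  (* The interior of [C (k, n)] would contain some [f x] with [x] in [B k], which almost openness
     puts into [O k n]. *)
  have [_ [[x Bx <-] Cx]] := Ccl _ (nbhs_interior Cy).
  have [_ []] := interior_subset Cx.
  have nB : nbhs x (B k) by apply: open_nbhs_nbhs.
  have [l [lx lB lsm]] := BP x (B k) n nB; exists l; first by split.
  by apply: aof; apply: open_nbhs_nbhs.
have [k0 [k0x k0V _]] := BP x V 0%N nV.
have : nbhs (f x) (closure (f @` B k0)) by apply: aof; apply: open_nbhs_nbhs.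
apply: (@filterS _ (nbhs (f x))) => y yk0 yC.
have step (n : nat) k : exists l, closure (f @` B k) y ->
    finer n k l /\ closure (f @` B l) y.
  have [yk|] := pselect (closure (f @` B k) y); last by exists k.
  have := yC (k, n); rewrite /C /= => /not_andP [//|/contrapT [l ln ly]].
  by exists l => _; split=> //; exact: interior_subset ly.
have /choice [g gP] : forall nk : nat * (nat * nat), exists l,
    closure (f @` B nk.2) y -> finer nk.1 nk.2 l /\ closure (f @` B l) y.
  by move=> [n k]; exact: step.
pose s := fix s n := if n is m.+1 then g (m, s m) else k0.
have sy n : closure (f @` B (s n)) y.
  by elim: n => //= n IH; have [] := gP (n, s n) IH.
have sf n : finer n (s n) (s n.+1) by have [] := gP (n, s n) (sy n).
have sD m n : (m <= n)%N -> B (s n) `<=` B (s m).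
  elim: n => [|n IH]; first by rewrite leqn0 => /eqP ->.
  rewrite leq_eqVlt => /predU1P[<-//|/ltnSE/IH]; apply: subset_trans.
  by apply: subset_trans (sf n).1; exact: subset_closure.
pose F := filter_from [set: nat] (fun n => h @` B (s n)).
have FF : ProperFilter F.
  apply: filter_from_proper; last first.
    move=> n _; have [_ [[a Ba _] _]] := sy n _ filterT.
    by exists (h a), a.
  apply: filter_from_filter; first by exists 0%N.
  move=> m n _ _; exists (maxn m n) => // _ [a Ba <-].
  by split; exists a => //; apply: sD Ba; rewrite ?leq_maxl ?leq_maxr.
have [z Fz] : exists z : Y, F --> z.
  apply: (cY F FF) => E; rewrite -entourage_ballE => -[e /= e0 eE].
  have [n] := @ltr_add_invr R 0 e e0; rewrite add0r => ne.
  exists (h @` B (s n.+1), h @` B (s n.+1)); first by split; exists n.+1.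
  move=> [_ _] [/= [a Ba <-] [b Bb <-]]; apply: eE => /=.
  apply: le_ball (ltW ne) _ _; exact: (sf n).2.
have gB n : B (s n) (h' z).
  apply: (sf n).1 => A nA.
  have nA' : nbhs z (h' @^-1` A) by exact: hh'.1.
  have FB : F (h @` B (s n.+1)) by exists n.+1.
  have [_ [[a Ba <-]]] := filter_ex (filterI FB (Fz _ nA')).
  by rewrite /= hK' => Aa; exists a.
exists (h' z); first by apply: k0V; apply: subset_closure; exact: (gB 0%N).
(* The image of the limit and [y] cannot be separated: for large [n], [f] maps [B (s n.+1)] into
   [A1], and this image meets [A2]. *)
apply: hK => A1 A2 nA1 nA2.
have nA1' : nbhs z (h' @^-1` (f @^-1` A1)).
  by apply: hh'.1; exact: cf.
have /nbhs_ballP [e /= e0 eA] := nA1'.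
have [n] := @ltr_add_invr R 0 e e0; rewrite add0r => ne.
have [_ [[b Bb <-] A2b]] := sy n.+1 _ nA2; exists (f b); split=> //.
have := (sf n).2 _ _ (gB n.+1) Bb; rewrite h'K => /(le_ball (ltW ne)) /eA.
by rewrite /= hK'.
Qed.

End AlmostOpen.

(** * Flows *)

Lemma compact_initial (S : choiceType) (T : topologicalType) (f : S -> T) :
  compact (range f) -> compact [set: initial_topology f].
Proof.
move=> cA F FF _.
have FA : F (f @^-1` range f) by apply: filterS filterT => x _; exists x.
have [p [[x _ xp] clp]] := cA (f @ F) _ FA.
exists x; split=> // B C FB [_ [[D oD <-] Dx] DC].
have FfB : F (f @^-1` (f @` B)) by apply: filterS FB => y By; exists y.
have [|_ [[y By <-] Dy]] := clp _ D FfB.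
  by apply: open_nbhs_nbhs; rewrite -xp.
by exists y; split=> //; exact: DC.
Qed.

Lemma hausdorff_initial (S : choiceType) (T : topologicalType) (f : S -> T) :
  hausdorff_space T -> injective f -> hausdorff_space (initial_topology f).
Proof.
move=> hT injf x y clxy; apply: injf; apply: hT => A B nA nB.
have cf := @initial_continuous S T f.
by have [z [Az Bz]] := clxy _ _ (cf x A nA) (cf y B nB); exists (f z).
Qed.

(** The action laws and continuity are required only within [A], since translation of functions is
    shown to be jointly continuous only on suitable sets. The clause on entourages serves to
    transfer equicontinuity. *)
Lemma subflow_exists (G : topologicalGroupType) (T : uniformType) (A : set T)
    (a : G -> T -> T) :
  A !=set0 -> compact A -> hausdorff_space T ->
  (forall g x, A x -> A (a g x)) ->
  (forall x, A x -> a 1 x = x) ->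
  (forall g h x, A x -> a (g * h) x = a g (a h x)) ->
  (forall g x B, A x -> nbhs (a g x) B ->
     nbhs (g, x) [set p | A p.2 -> B (a p.1 p.2)]) ->
  exists (X : flow G) (i : X -> T),
    [/\ continuous i, injective i, range i = A,
        forall g x, i (gact g x) = a g (i x) &
        forall E, entourage E -> exists2 D, entourage D &
          forall x y, D (i x, i y) -> E (x, y)].
Proof.
move=> [x0 Ax0] cA hT aA a1 aM ac.
pose X := initial_topology (set_val : A -> T).
pose i : X -> T := set_val.
have iA (x : X) : A (i x) by exact: set_valP.
have injI : injective i by exact: val_inj.
have ri : range i = A.
  apply/seteqP; split=> [_ [x _ <-]//|x Ax].
  by exists (exist _ x (mem_set Ax) : X).
pose b g (x : X) : X := exist _ (a g (i x)) (mem_set (aA g _ (iA x))).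
have ib g x : i (b g x) = a g (i x) by [].
have b1 x : b 1 x = x by apply: injI; rewrite ib a1.
have bM g h x : b (g * h) x = b g (b h x) by apply: injI; rewrite !ib aM.
have ci : continuous i by exact: initial_continuous.
have bc : continuous (fun p : G * X => b p.1 p.2).
  move=> [g x] C [_ [[B oB <-] /= Bx BC]].
  have nB : nbhs (a g (i x)) B by apply: open_nbhs_nbhs.
  have [[V W] /= [nV nW] VW] := ac g (i x) B (iA x) nB.
  exists (V, i @^-1` W).
    by split=> //; exact: ci.
  move=> [h y] /= [Vh Wy]; apply: BC.
  exact: (VW (h, i y) (conj Vh Wy) (iA y)).
have Xn : [set: X] !=set0 by exists (exist _ x0 (mem_set Ax0) : X).
have cX : compact [set: X] by apply: compact_initial; rewrite ri.
have hX : hausdorff_space X by exact: hausdorff_initial.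
exists (@Flow G (@GSpace G X b b1 bM bc) Xn cX hX), i.
by split=> // E [D eD DE]; exists D => // x y Dxy; exact: (DE (x, y)).
Qed.

(** * Subflows, minimality and equicontinuity *)

Section FlowTheory.
Variable G : topologicalGroupType.
Implicit Types X Y : flow G.

Definition invariant (X : gspace G) (A : set X) :=
  forall g x, A x -> A (gact g x).

Lemma gact_continuousr (X : gspace G) (g : G) : continuous (@gact G X g).
Proof.
move=> x; apply: (@continuous_comp X (G * X)%type X (fun z => (g, z))
  (fun p => gact p.1 p.2)); last exact: gact_continuous.
exact: (cvg_pair (cvg_cst g) cvg_id).
Qed.

Lemma gact_continuousl (X : gspace G) (x : X) : continuous (fun g => gact g x).
Proof.
move=> g; apply: (@continuous_comp G (G * X)%type X (fun z => (z, x))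
  (fun p => gact p.1 p.2)); last exact: gact_continuous.
exact: (cvg_pair cvg_id (cvg_cst x)).
Qed.

Lemma gactK (X : gspace G) (g : G) (x : X) : gact g^-1 (gact g x) = x.
Proof. by rewrite -gactM mulVg gact1. Qed.

Lemma gactKV (X : gspace G) (g : G) (x : X) : gact g (gact g^-1 x) = x.
Proof. by rewrite -gactM mulgV gact1. Qed.

Lemma closed_subflow X (A : set X) : A !=set0 -> closed A -> invariant A ->
  exists (Y : flow G) (i : Y -> X),
    [/\ continuous i, equivariant i, injective i, range i = A &
        equicontinuous_action X -> equicontinuous_action Y].
Proof.
move=> An cA iA.
have [|||||||Y [i [ci ii ri ei uE]]] := @subflow_exists G X A (@gact G X).
- by [].
- exact: subclosed_compact cA (@flow_compact _ X) _.
- exact: flow_hausdorff.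
- exact: iA.
- by move=> x _; rewrite gact1.
- by move=> g h x _; rewrite gactM.
- move=> g x B _ nB.
  have [[V W] nVW VWB] := @gact_continuous G X (g, x) B nB.
  by exists (V, W) => // p /VWB Bp _.
exists Y, i; split=> // eX y E /uE [D eD DE].
have [U nU UD] := eX (i y) D eD; exists (i @^-1` U); first exact: ci.
by move=> g z Uz; apply: DE; rewrite !ei; exact: UD.
Qed.

Lemma minimalP X : minimal X <->
  forall A : set X, closed A -> A !=set0 -> invariant A -> A = [set: X].
Proof.
split=> [mX A cA [x Ax] iA|mX x].
  apply/seteqP; split=> // y _; apply: cA => B nB.
  have [|z [Bz [g _ gz]]] := mX x B° _ (open_interior B).
    by exists y; exact: nbhs_singleton (nbhs_interior nB).
  by exists z; split; [rewrite -gz; exact: iA|exact: interior_subset].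
have cX : closure (orbit x) = setT.
  apply: mX; first exact: closed_closure.
    by exists x; apply: subset_closure; exists 1 => //; rewrite gact1.
  move=> g y cy B nB.
  have [_ [[h _ <-] Bh]] := cy _ (@gact_continuousr X g y _ nB).
  exists (gact g (gact h x)); split=> //.
  by exists (g * h) => //; rewrite gactM.
move=> O [y Oy] oO; have : closure (orbit x) y by rewrite cX.
by move=> /(_ O (open_nbhs_nbhs (conj oO Oy))) [z [oz Oz]]; exists z.
Qed.

Lemma closure_invariant X (A : set X) : invariant A -> invariant (closure A).
Proof.
move=> iA g y cy B nB.
have [z [Az Bz]] := cy _ (@gact_continuousr X g y _ nB).
by exists (gact g z); split=> //; exact: iA.
Qed.

Lemma orbit_invariant (X : gspace G) (x : X) : invariant (orbit x).
Proof. by move=> g _ [h _ <-]; exists (g * h) => //; rewrite gactM. Qed.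

Lemma orbit_refl (X : gspace G) (x : X) : orbit x x.
Proof. by exists 1 => //; rewrite gact1. Qed.

Lemma minimal_subflow X : exists (Y : flow G) (i : Y -> X),
  [/\ continuous i, equivariant i, injective i & minimal Y].
Proof.
have [||||A [_ [cA iA] An Amin]] :=
  @exists_minimal_closed X (fun A => closed A /\ invariant A) setT
    (@flow_compact _ X).
- by move=> A [].
- move=> F FP; split; first by apply: closed_bigI => A /FP[].
  by move=> g x Fx A FA; apply: (FP _ FA).2; exact: Fx.
- by split=> //; exact: closedT.
- exact: flow_nonempty.
have [Y [i [ci ei ii ri _]]] := closed_subflow An cA iA.
exists Y, i; split=> //; apply/minimalP => B cB [b Bb] iB.
have iBA : i @` B = A.
  apply: Amin.
  - split.
      by apply: closed_map => //; [exact: flow_compact|exact: flow_hausdorff].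
    by move=> g _ [y By <-]; exists (gact g y); [exact: iB|exact: ei].
  - by exists (i b), b.
  - by rewrite -ri => _ [y By <-]; exists y.
apply/seteqP; split=> // y _.
have : A (i y) by rewrite -ri; exists y.
by rewrite -iBA => -[z Bz /ii <-].
Qed.

Lemma minimal_onto X Y (f : X -> Y) :
  continuous f -> equivariant f -> minimal Y -> range f = [set: Y].
Proof.
move=> cf ef /minimalP; apply.
- by apply: closed_map => //; [exact: flow_compact|exact: flow_hausdorff].
- by have [x _] := @flow_nonempty _ X; exists (f x), x.
- by move=> g _ [x _ <-]; exists (gact g x).
Qed.

Lemma uniform_eq (U : uniformType) (x y : U) : hausdorff_space U ->
  (forall E, entourage E -> E (x, y)) -> x = y.
Proof.
move=> hU xy; apply: hU => A B /nbhsP [E eE EA] nB.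
exists y; split; last exact: nbhs_singleton.
by apply: EA; apply/xsectionP; exact: xy.
Qed.

(** When [gact g x] and [gact g y] are both near [z], equicontinuity at [z], used for [g^-1], puts
    [x] and [y] both near [gact g^-1 z]. *)
Lemma equicontinuous_distal X : equicontinuous_action X -> distal X.
Proof.
move=> eX x y; have [->|nxy] := pselect (x = y); first by left.
right=> -[F [FF [z [xz yz]]]]; apply: nxy.
apply: uniform_eq; first exact: flow_hausdorff.
move=> E eE.
pose D := split_ent E `&` (split_ent E)^-1%relation.
have eD : entourage D.
  by apply: filterI; [|apply: entourage_inv]; exact: entourage_split_ent.
have [U nU UE] := eX z _ eD.
have FU : F ([set g | U (gact g x)] `&` [set g | U (gact g y)]).
  by apply: filterI; [exact: xz|exact: yz].
have [g [/= Ux Uy]] := filter_ex FU.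
have [_ Ex] := UE g^-1 _ Ux; have [Ey _] := UE g^-1 _ Uy.
rewrite /= gactK in Ex; rewrite gactK in Ey.
exact: (entourage_split (gact g^-1 z)) Ex Ey.
Qed.

(** If [gact g x] is near [y], equicontinuity at [y] puts [x] near [gact g^-1 y]. *)
Lemma equicontinuous_closure_orbit X (x y : X) : equicontinuous_action X ->
  closure (orbit x) y -> closure (orbit y) x.
Proof.
move=> eX cy B /nbhsP [E eE EB].
have [U nU UE] := eX y _ (entourage_inv eE).
have [_ [[g _ <-] Ug]] := cy _ nU.
exists (gact g^-1 y); split; first by exists g^-1.
apply: EB; apply/xsectionP.
by have := UE g^-1 _ Ug; rewrite gactK.
Qed.

(** By the symmetry of orbit closures, every nonempty closed invariant subset of the orbit closure
    of [x] contains [x]. *)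
Lemma equicontinuous_orbit_minimal X (x : X) : equicontinuous_action X ->
  exists (Y : flow G) (i : Y -> X) (y : Y), [/\ continuous i, equivariant i,
    minimal Y, equicontinuous_action Y & i y = x].
Proof.
move=> eX; pose A := closure (orbit x).
have Ax : A x by apply: subset_closure; exact: orbit_refl.
have iA : invariant A by apply/closure_invariant/orbit_invariant.
have [Y [i [ci ei ii ri eY]]] :=
  closed_subflow (ex_intro _ x Ax) (@closed_closure _ _) iA.
have riA : range i = A by [].
have : A x by []; rewrite -riA => -[y _ yx].
exists Y, i, y; split=> //; last exact: eY.
apply/minimalP => B cB [b Bb] iB.
have iBc : closed (i @` B).
  by apply: closed_map => //; [exact: flow_compact|exact: flow_hausdorff].
have iBi : invariant (i @` B).
  by move=> g _ [z Bz <-]; exists (gact g z); [exact: iB|exact: ei].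
have sub (z : X) : (i @` B) z -> closure (orbit z) `<=` i @` B.
  move=> Bz; rewrite [X in _ `<=` X](closure_id _).1 //; apply: closureS.
  by move=> _ [g _ <-]; exact: iBi.
have Bx : (i @` B) x.
  apply: (sub (i b)); first by exists b.
  apply: equicontinuous_closure_orbit => //.
  by have : A (i b) by rewrite -riA; exists b.
apply/seteqP; split=> // z _.
have : A (i z) by rewrite -riA; exists z.
by move=> /(sub _ Bx) [z' Bz' /ii <-].
Qed.

End FlowTheory.

Lemma gspace_iso_sym (G : topologicalGroupType) (X Y : gspace G) :
  gspace_iso X Y -> gspace_iso Y X.
Proof.
move=> [f [hf ef]]; have [g [hg fg gf]] := homeomorphism_inv hf.
exists g; split=> // h y; apply: (can_inj fg).
by rewrite ef !gf.
Qed.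

Lemma gspace_iso_trans (G : topologicalGroupType) (X Y Z : gspace G) :
  gspace_iso X Y -> gspace_iso Y Z -> gspace_iso X Z.
Proof.
move=> [f [[cf [f' [cf' ff' f'f]]] ef]] [g [[cg [g' [cg' gg' g'g]]] eg]].
exists (g \o f); split; last by move=> h x; rewrite /= ef eg.
split; first by move=> x; apply: continuous_comp; [exact: cf|exact: cg].
exists (f' \o g'); split=> [x|x|x].
- by apply: continuous_comp; [exact: cg'|exact: cf'].
- by rewrite /= gg' ff'.
- by rewrite /= f'f g'g.
Qed.

(** * The Ellis group of a distal flow *)

(** A compact right topological group: only right translations are continuous at first. [G] acts by
    left multiplication through the orbit of the identity. *)
Definition group_flow (G : topologicalGroupType) (K : flow G)
    (m : K -> K -> K) (e : K) (i : K -> K) :=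
  [/\ associative m, left_id e m, left_inverse e i m,
      forall q, continuous (m^~ q) & forall g p, gact g p = m (gact g e) p].

Section Ellis.
Variables (G : topologicalGroupType) (D : flow G).
Hypothesis distalD : distal D.
Local Notation T := {ptws D -> D}.

Let tr (g : G) : T := fun x => gact g x.
(** The enveloping semigroup of [D]. *)
Let A : set T := closure (range tr).

Let hT : hausdorff_space T.
Proof. by apply: ptws_hausdorff; exact: flow_hausdorff. Qed.

Let cT : compact [set: T].
Proof.
have := @ptws_compact D D setT (@flow_compact _ D).
by congr compact; apply/seteqP; split.
Qed.

Let comp_continuous (q : T) : continuous (fun p : T => (p \o q : T)).
Proof.
by move=> p; apply: ptws_continuous => x; exact: (@eval_continuous D D (q x)).
Qed.

Let act_continuous (x : G * T) :
  {for x, continuous (fun y : G * T => (fun z => gact y.1 (y.2 z)) : T)}.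
Proof.
apply: ptws_continuous => z.
apply: (@continuous_comp (G * T)%type (G * D)%type D
  (fun y => (y.1, y.2 z)) (fun y => gact y.1 y.2)); last exact: gact_continuous.
apply: cvg_pair; first exact: cvg_fst.
apply: (@continuous_comp (G * T)%type T D snd (fun p => p z)).
  exact: cvg_snd.
exact: (@eval_continuous D D z x.2).
Qed.

Let A_act g p : A p -> A (fun x => gact g (p x)).
Proof.
move=> Ap B nB.
have [[V W] /= [nV nW] VW] := act_continuous (x := (g, p)) nB.
have [_ [[h _ <-] Wh]] := Ap _ nW.
exists (tr (g * h)); split; first by exists (g * h).
have := VW (g, tr h) (conj (nbhs_singleton nV) Wh); congr B.
by apply/funext => x; rewrite /tr /= gactM.
Qed.

Let A_comp p q : A p -> A q -> A (p \o q).
Proof.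
move=> Ap Aq; apply: (@closed_closure _ (range tr)) => B nB.
have [_ [[g _ <-] Bg]] := Ap _ (comp_continuous nB).
by exists (tr g \o q); split=> //; exact: A_act.
Qed.

Let A_id : A id.
Proof.
apply: subset_closure; exists 1 => //.
by apply/funext => x; rewrite /tr gact1.
Qed.

(** The traces on [G] of the neighborhoods of [p] form a filter along which [x] and [y] tend to
    [p x] and [p y]; equal limits would make them proximal. *)
Let A_inj p : A p -> injective p.
Proof.
move=> Ap x y pxy; have [//|[]] := distalD x y.
pose F : set_system G := filter_from (nbhs p) (fun V => tr @^-1` V).
have FP : ProperFilter F.
  apply: filter_from_proper; last first.
    by move=> V /Ap [_ [[g _ <-] Vg]]; exists g.
  apply: filter_from_filter; first by exists setT; exact: filterT.
  by move=> V W nV nW; exists (V `&` W) => //; exact: filterI.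
have cvx z : gact g z @[g --> F] --> p z.
  by move=> B nB; exists [set q : T | B (q z)] => //; exact: eval_continuous nB.
by exists F; split=> //; exists (p x); split; rewrite // pxy.
Qed.

(** The closed semigroup of all [q \o p] contains an idempotent, by the Ellis-Numakura argument, and
    an injective idempotent is the identity. *)
Let A_linv p : A p -> exists2 q, A q & q \o p = id.
Proof.
move=> Ap; pose S0 : set T := (fun q : T => (q \o p : T)) @` A.
pose P (S : set T) := closed S /\ forall f g, S f -> S g -> S (f \o g).
have Rcl (S : set T) (f : T) : closed S -> closed [set (g \o f : T) | g in S].
  by move=> cS; apply: closed_map => //; exact: comp_continuous.
have [||||S [SS0 [cS SM] [f Sf] Smin]] := @exists_minimal_closed T P S0 cT.
- by move=> S [].
- move=> F FP; split; first by apply: closed_bigI => S /FP[].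
  by move=> f g Ff Fg S FS; apply: (FP _ FS).2; [exact: Ff|exact: Fg].
- split; first by apply: Rcl; exact: closed_closure.
  move=> _ _ [f Af <-] [g Ag <-]; exists (f \o p \o g) => //.
  by apply: A_comp => //; exact: A_comp.
- by exists p, id.
(* Minimality is used twice: it gives [S f = S], hence some [g] with [g \o f = f], and then
   [q \o f = f] for every [q] in [S], in particular for [f]. *)
have SfS : [set (g \o f : T) | g in S] = S.
  apply: Smin.
  - split; first exact: Rcl.
    move=> _ _ [g Sg <-] [h Sh <-]; exists (g \o f \o h) => //.
    by apply: (SM) => //; exact: SM.
  - by exists (f \o f), f.
  - by move=> _ [g Sg <-]; exact: SM.
have [g Sg gf] : [set (g \o f : T) | g in S] f by rewrite SfS.
have SE : S `&` [set q : T | (q \o f : T) = f] = S.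
  apply: Smin; last by move=> q [].
    split.
      apply: closedI => //.
      apply: (@preimage_closed _ _ (fun q : T => (q \o f : T)) [set f]).
        by move=> q _; exact: comp_continuous.
      by apply: accessible_closed_set1; exact: hausdorff_accessible.
    move=> q r [Sq qf] [Sr rf]; split; first exact: SM.
    by rewrite /= -compA rf.
  by exists g.
have [_ /= ff] : (S `&` [set q : T | (q \o f : T) = f]) f by rewrite SE.
have [q Aq qp] := SS0 _ Sf; exists q; rewrite // qp.
have Af : A f by rewrite -qp; exact: A_comp.
by apply/funext => x; apply: (A_inj Af); exact: (congr1 (fun h => h x) ff).
Qed.

Lemma ellis_group : exists (K : flow G) (m : K -> K -> K) (e : K) (i : K -> K),
  [/\ group_flow m e i, minimal K, distal K & minimal D -> maps_onto K D].
Proof.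
have [|||||||K [j [cj ij rj ej _]]] := @subflow_exists G T A
    (fun g p => (fun x => gact g (p x)) : T).
- by exists id.
- by apply: subclosed_compact cT _ => //; exact: closed_closure.
- exact: hT.
- by move=> g p Ap; exact: A_act.
- by move=> p _; apply/funext => x; rewrite gact1.
- by move=> g h p _; apply/funext => x; rewrite gactM.
- move=> g p B _ nB; have [[V W] nVW VWB] := act_continuous (x := (g, p)) nB.
  by exists (V, W) => // y /VWB By _.
have Aj k : A (j k) by rewrite -rj; exists k.
have jA p : A p -> exists k, j k = p by rewrite -rj => -[k _ <-]; exists k.
have [e je] := jA _ A_id.
have /choice [m' m'P] : forall kl : K * K, exists k, j k = j kl.1 \o j kl.2.
  by move=> kl; apply: jA; exact: A_comp.
pose m k l := m' (k, l).
have jm k l : j (m k l) = j k \o j l by exact: (m'P (k, l)).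
have /choice [i iP] : forall k, exists l, j l \o j k = id.
  by move=> k; have [q /jA [l <-] qk] := A_linv (Aj k); exists l.
(* [j] is an injective closed map, so continuity into [K] can be tested after [j]. *)
have jc (X : topologicalType) (f : X -> K) :
    continuous (j \o f) -> continuous f.
  move=> cjf; apply/continuous_closedP => C cC.
  rewrite (_ : f @^-1` C = (j \o f) @^-1` (j @` C)).
    have /continuous_closedP := cjf; apply.
    by apply: closed_map => //; exact: flow_compact.
  apply/seteqP; split=> [x Cx|x [k Ck kx]]; first by exists (f x).
  by rewrite /preimage /mkset -(ij _ _ kx).
(* If [p] and [q] were proximal in [K], evaluation would make [j p x] and [j q x] proximal in [D]
   for every [x]. *)
have dK : distal K.
  move=> p q; have [->|pq] := pselect (p = q); first by left.
  right=> -[F [FF [z [pz qz]]]]; apply: pq; apply: ij; apply/funext => x.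
  have [//|[]] := distalD (j p x) (j q x); exists F; split=> //.
  exists (j z x).
  have cjx : continuous (fun k => j k x).
    move=> k; apply: (@continuous_comp K T D j (fun p : T => p x)).
      exact: cj.
    exact: eval_continuous.
  have ev k : gact g k @[g --> F] --> z -> gact g (j k x) @[g --> F] --> j z x.
    move=> kz B nB; have := kz _ (cjx z B nB).
    by apply: (@filterS _ F) => g; rewrite /= ej.
  by split; exact: ev.
have gm g p : gact g p = m (gact g e) p.
  by apply: ij; rewrite jm !ej je.
have lid : left_id e m by move=> k; apply: ij; rewrite jm je.
have linv : left_inverse e i m by move=> k; apply: ij; rewrite jm iP je.
have cR q : continuous (m^~ q).
  apply: jc; rewrite (_ : _ \o _ = (fun p : T => (p \o j q : T)) \o j).
    move=> k; apply: continuous_comp; first exact: cj.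
    exact: comp_continuous.
  by apply/funext => k; rewrite /= jm.
have mA : associative m by move=> k l n; apply: ij; rewrite !jm.
exists K, m, e, i; split=> //.
  (* The closed set [E] of all [p] with [m p c] in [C] contains the orbit of [e], hence everything;
     its element [m k (i c)] yields [k] in [C]. *)
  apply/minimalP => C cC [c Cc] iC; apply/seteqP; split=> // k _.
  pose E := (m^~ c) @^-1` C.
  have cE : closed E by have /continuous_closedP := cR c; exact.
  have AE : A `<=` j @` E.
    rewrite [X in _ `<=` X](closure_id _).1; last first.
      by apply: closed_map => //; exact: flow_compact.
    apply: closureS => _ [g _ <-]; exists (gact g e).
      by rewrite /E /= -gm; exact: iC.
    by rewrite ej je.
  have [p Ep /ij pE] := AE _ (Aj (m k (i c))).
  move: Ep; rewrite /E /= pE -mA linv.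
  by have <- : k = m k e by apply: ij; rewrite jm je.
move=> mD; have [x0 _] := @flow_nonempty _ D.
exists (fun k => j k x0).
have c : continuous (fun k => j k x0).
  move=> k; apply: (@continuous_comp K T D j (fun p : T => p x0)).
    exact: cj.
  exact: eval_continuous.
have eq : equivariant (fun k => j k x0) by move=> g k; rewrite ej.
by split=> //; exact: minimal_onto.
Qed.
End Ellis.

(** * Continuity of the group operations by Baire category *)

Section GroupFlow.
Variables (G : topologicalGroupType) (K : flow G).
Variables (m : K -> K -> K) (e : K) (i : K -> K).
Hypothesis gfK : group_flow m e i.

Let mA : associative m. Proof. by case: gfK. Qed.
Let me1 : left_id e m. Proof. by case: gfK. Qed.
Let mV : left_inverse e i m. Proof. by case: gfK. Qed.
Let cR : forall q, continuous (m^~ q). Proof. by case: gfK. Qed.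
Let gm : forall g p, gact g p = m (gact g e) p. Proof. by case: gfK. Qed.

Lemma group_flow_mulV : right_inverse e i m.
Proof.
move=> p; rewrite -[LHS]me1 -(mV (i p)) -mA (mA (i p)) mV me1.
by rewrite mV.
Qed.

Lemma group_flow_mul1 : right_id e m.
Proof. by move=> p; rewrite -(mV p) mA group_flow_mulV me1. Qed.

Local Notation mVr := group_flow_mulV.
Local Notation m1 := group_flow_mul1.

Let cK : compact [set: K]. Proof. exact: flow_compact. Qed.
Let hK : hausdorff_space K. Proof. exact: flow_hausdorff. Qed.

Section Continuity.
Hypotheses (minK : minimal K) (baseK : countably_based K).

(** By density of the orbit of [e], choose [g n] sending [e] into each of [P 0, ..., P n] that
    contains [p]. Then [gact (g n) e] tends to [p], and right translation by [r] is continuous. *)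
Lemma group_flow_seq (p : K) : exists g : nat -> G, forall r B,
  nbhs (m p r) B -> exists N, forall n, (N <= n)%N -> B (gact (g n) r).
Proof.
have [P [oP PP]] := baseK.
have /choice [g gP] : forall n, exists g : G,
    forall k, (k <= n)%N -> P k p -> P k (gact g e).
  move=> n.
  have : nbhs p [set q | forall k, (k <= n)%N -> P k p -> P k q].
    elim: n => [|n IH].
      have [P0|nP0] := pselect (P 0%N p).
        apply: (@filterS _ (nbhs p) _ (P 0%N)).
          by move=> q q0 k; rewrite leqn0 => /eqP ->.
        by apply: open_nbhs_nbhs; split.
      by apply: filterE => q k; rewrite leqn0 => /eqP ->.
    have : nbhs p [set q | P n.+1 p -> P n.+1 q].
      have [P0|nP0] := pselect (P n.+1 p).
        apply: (@filterS _ (nbhs p) _ (P n.+1)); first by move=> q qn _.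
        by apply: open_nbhs_nbhs; split.
      by apply: filterE => q /nP0.
    move=> /(filterI IH); apply: (@filterS _ (nbhs p)) => q [q1 q2] k.
    by rewrite leq_eqVlt => /predU1P[->//|/ltnSE]; exact: q1.
  rewrite nbhsE => -[B [oB Bp] BP].
  have [q [Bq [g _ gq]]] := minK e (ex_intro _ p Bp) oB.
  by exists g; apply: BP; rewrite gq.
exists g => r B nB.
have [N Np NB] := based_nbhs cK hK PP (cR (q := r) nB).
exists N => n Nn; rewrite gm; apply: NB; apply: subset_closure.
exact: gP.
Qed.

(* The points of continuity of the pointwise limit [m p] of a sequence of
   homeomorphisms exist by Baire's theorem, and right translations carry one of
   them to any other point. *)
Lemma group_flow_continuousl (p : K) : continuous (m p).
Proof.
have [g gP] := group_flow_seq p; have [P [oP PP]] := baseK.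
(* [C (b, n)] collects the points sent into the closure of [P b] by every [g k] with [k >= n]. A
   point interior to each [C (b, n)] containing it is a point of continuity of the limit. *)
pose C (bn : nat * nat) :=
  \bigcap_(k in [set k | (bn.2 <= k)%N]) (gact (g k)) @^-1` closure (P bn.1).
have [|||r0 _ r0P] := @baire_closed_count _ K C setT cK hK.
- move=> bn; apply: closed_bigI => k _.
  have /continuous_closedP := @gact_continuousr G K (g k); apply.
  exact: closed_closure.
- exact: openT.
- by exists e.
have c0 : {for r0, continuous (m p)}.
  move=> O nO; have [b br bO] := based_nbhs cK hK PP nO.
  have [n nP] := gP r0 (P b) (open_nbhs_nbhs (conj (oP b) br)).
  have /r0P : C (b, n) r0 by move=> k nk; apply: subset_closure; exact: nP.
  apply: (@filterS _ (nbhs r0)) => r Cr; apply: bO => B nB.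
  have [N NP] := gP r _ (nbhs_interior nB); pose k := maxn n N.
  have nBk : nbhs (gact (g k) r) B by apply: NP; exact: leq_maxr.
  exact: (Cr k (leq_maxl _ _) B nBk).
move=> q; have E : m p = (m^~ (m (i r0) q)) \o m p \o (m^~ (m (i q) r0)).
  apply/funext => r /=.
  by rewrite -!mA (mA r0) mVr me1 mV m1.
rewrite E; apply: continuous_comp; first exact: cR.
apply: continuous_comp; last exact: cR.
by rewrite /= mA mVr me1.
Qed.

(** The set [C (a, b)] of all [p] with [p (P a)] inside the closure of [P b] is closed because right
    translations are continuous. At a [p0] on the boundary of none of these sets, multiplication is
    jointly continuous at every [(p0, r)]. *)
Lemma group_flow_continuous : continuous (fun p : K * K => m p.1 p.2).
Proof.
have [P [oP PP]] := baseK.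
pose C (ab : nat * nat) :=
  \bigcap_(r in P ab.1) (m^~ r) @^-1` closure (P ab.2).
have [|||p0 _ p0P] := @baire_closed_count _ K C setT cK hK.
- move=> ab; apply: closed_bigI => r _.
  have /continuous_closedP := @cR r; apply.
  exact: closed_closure.
- exact: openT.
- by exists e.
have c0 r : {for (p0, r), continuous (fun p : K * K => m p.1 p.2)}.
  move=> O /= nO; have [b br bO] := based_nbhs cK hK PP nO.
  have nb : nbhs (m p0 r) (P b) by apply: open_nbhs_nbhs.
  have [a ar aP] := based_nbhs cK hK PP (group_flow_continuousl nb).
  have /p0P : C (a, b) p0.
    by move=> r' ar'; apply/subset_closure/aP/subset_closure.
  move=> nC; exists ((C (a, b))°, P a).
    split; first exact: (nbhs_interior nC).
    by apply: open_nbhs_nbhs; split; [exact: oP|].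
  move=> [p' r'] /= [/interior_subset Cp ar']; apply: bO.
  exact: Cp.
move=> [p q].
(* Left translations, already continuous, carry [p0] to [p]: [p' q' = p p0^-1 ((p0 p^-1 p') q')]. *)
have E : (fun pq : K * K => m pq.1 pq.2) =
    m (m p (i p0)) \o (fun pq : K * K => m pq.1 pq.2) \o
    (fun pq : K * K => (m (m p0 (i p)) pq.1, pq.2)).
  apply/funext => -[p' q'] /=; rewrite !mA -(mA p) mV m1 mVr.
  by rewrite me1.
rewrite E; apply: continuous_comp; last first.
  apply: continuous_comp; last exact: group_flow_continuousl.
  by rewrite /= -mA mV m1; exact: c0.
apply: cvg_pair; last exact: cvg_snd.
apply: continuous_comp; first exact: cvg_fst.
exact: group_flow_continuousl.
Qed.

(** The preimage of a closed [C] is the projection of the compact set of pairs with product [e] and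
    second member in [C]. *)
Lemma group_flow_inv_continuous : continuous i.
Proof.
apply/continuous_closedP => C cC.
pose Z := [set pq : K * K | m pq.1 pq.2 = e /\ C pq.2].
rewrite (_ : _ @^-1` _ = fst @` Z); last first.
  apply/seteqP; split=> [p Cp|_ [[p q] [/= pq Cq] <-]].
    by exists (p, i p) => //; split=> //=; exact: mVr.
  by rewrite /= (_ : i p = q) // -[i p]m1 -pq mA mV me1.
apply: closed_map => //.
- by rewrite -setXTT; exact: compact_setX.
- by move=> p; exact: cvg_fst.
- rewrite (_ : Z = (fun pq => m pq.1 pq.2) @^-1` [set e] `&` snd @^-1` C) //.
  apply: closedI.
    have /continuous_closedP := group_flow_continuous; apply.
    by apply: accessible_closed_set1; exact: hausdorff_accessible.
  have /continuous_closedP : continuous (@snd K K) by move=> p; exact: cvg_snd.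
  exact.
Qed.

(** Joint continuity and compactness make all left translations equicontinuous at once, and [G] acts
    by some of them. *)
Lemma group_flow_equicontinuous : equicontinuous_action K.
Proof.
move=> x E eE.
suff nU : \forall y \near x, forall p, E (m p x, m p y).
  exists [set y | forall p, E (m p x, m p y)] => // g y /(_ (gact g e)).
  by rewrite -!gm.
have /compact_near_coveringP := cK.
move=> /(_ K (nbhs x) (fun y p => E (m p x, m p y)) _) H.
have : \forall y \near x, [set: K] `<=` (fun p => E (m p x, m p y)).
  apply: H => p _.
  pose S := split_ent E.
  have eS : entourage S by exact: entourage_split_ent.
  have nS : nbhs (m p x)
      (xsection S (m p x) `&` xsection (S^-1)%relation (m p x)).
    by apply: filterI; apply: nbhs_entourage; last exact: entourage_inv.
  have [[V W] /= [nV nW] VW] := group_flow_continuous (x := (p, x)) nS.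
  exists (V, W) => // -[p' y] /= [Vp Wy].
  have [_ /xsectionP h1] := VW (p', x) (conj Vp (nbhs_singleton nW)).
  have [/xsectionP h2 _] := VW (p', y) (conj Vp Wy).
  exact: (entourage_split (m p x)) h1 h2.
by apply: (@filterS _ (nbhs x)) => y yP p; exact: yP.
Qed.

End Continuity.
End GroupFlow.

(** * Flows of right uniformly continuous functions *)

(** A basic entourage restricts finitely many coordinates, so it contains a uniform one. *)
Lemma ptws_entourage (R : realType) (I : eqType)
    (E : set ({ptws I -> R} * {ptws I -> R})) : entourage E ->
  exists2 e : R, (0 < e)%R & forall f g : {ptws I -> R},
    (forall i, `|f i - g i| <= e)%R -> E (f, g).
Proof.
pose F : set_system ({ptws I -> R} * {ptws I -> R}) :=
  filter_from [set e : R | (0 < e)%R]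
    (fun e => [set fg | forall i, (`|fg.1 i - fg.2 i| <= e)%R]).
have FF : Filter F.
  apply: filter_from_filter; first by exists 1%R => /=.
  move=> a b /= a0 b0; exists (Num.min a b); first by rewrite /= lt_min a0.
  by move=> fg /= H; split=> i; have := H i; rewrite le_min => /andP[].
suff EF : entourage E -> F E.
  by move=> /EF [e e0 eE]; exists e => // f g fg; exact: eE.
move=> [B [Fs _ <-] BE].
apply: filterS BE _; apply: filter_bigI => -[[i V] /= /[dup] /asboolP].
move=> [W eW WV] _ _.
move: eW; rewrite -entourage_ballE => -[e /= e0 eW].
(* Halving turns the weak inequality into the strict one of [ball]. *)
exists (e / 2)%R; first by rewrite /= divr_gt0.
move=> [f g] /= fg; apply: WV; apply: eW; rewrite /ball /=.
by apply: le_lt_trans (fg i) _; rewrite ltr_pdivrMr// ltr_pMr// ltr1n.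
Qed.

Section Urysohn.
Local Open Scope ring_scope.

Lemma dist_min_le (R : realType) (a b c : R) :
  `|Num.min a c - Num.min b c| <= `|a - b|.
Proof.
have := ler_norm (a - b); have := ler_norm (b - a); rewrite (distrC b) => h1 h2.
by rewrite ler_norml !minElt; case: ltP => ac; case: ltP => bc;
  apply/andP; split; lra.
Qed.

(** The function is the distance to [A] in a gauge pseudometric of [E], cut off at a radius [c]
    whose balls stay within [E], and divided by [c]; the triangle inequality makes it Lipschitz. *)
Lemma uniform_urysohn (R : realType) (T : uniformType) (A B : set T)
    (E : set (T * T)) : entourage E -> A `*` B `&` E = set0 ->
  exists f : T -> R, [/\ forall x, 0 <= f x <= 1,
    forall x, A x -> f x = 0, forall x, B x -> f x = 1 &
    forall e, 0 < e -> exists2 D, entourage D &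
      forall x y, D (x, y) -> `|f x - f y| <= e].
Proof.
(* The distance to an empty [A] is infinite, so that case takes the constant [1]. *)
move=> eE AB0; have [->|/set0P [a Aa]] := eqVneq A set0.
  exists (fun=> 1); split=> // [x|e e0]; first by rewrite ler01 lexx.
  by exists setT; [exact: entourageT|move=> x y _; rewrite subrr normr0 ltW].
pose T' := [the pseudoMetricType R of gauge.type eE].
have [c c0 cAB] : exists2 c : R, 0 < c &
    forall x y : T', A x -> B y -> ~ ball x c y.
  have : @entourage T' E by exists 0%N => //= x [].
  rewrite -entourage_ballE => -[c /= c0 cE]; exists c => // x y Ax By xy.
  have Exy := cE (x, y) xy.
  by have : set0 (x, y) by rewrite -AB0; split.
pose A' : set T' := A.
have dfin (x : T') : edist_inf A' x \is a fin_num.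
  rewrite ge0_fin_numE ?edist_inf_ge0//.
  apply: (@le_lt_trans _ _ (edist (x, a : T'))).
    by apply: ereal_inf_lbound; exists a.
  rewrite -ge0_fin_numE ?edist_ge0//; apply/edist_finP; exists 2 => //.
  exact: countable_uniform.countable_uniform_bounded.
pose d (x : T') : R := fine (edist_inf A' x).
have d0 x : 0 <= d x by exact/fine_ge0/edist_inf_ge0.
have dlip (x y : T') r : 0 < r -> ball x r y -> d x <= r + d y.
  move=> r0 xy; rewrite -lee_fin EFinD !fineK//.
  apply: le_trans (edist_inf_triangle A' x y) _.
  by rewrite leeD2r//; exact: edist_fin.
exists (fun x => Num.min (d x) c / c); split.
- move=> x; apply/andP; split.
    by apply: divr_ge0; rewrite ?le_min ?d0 ltW.
  by rewrite ler_pdivrMr// mul1r ge_min lexx orbT.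
- by move=> x Ax; rewrite /d edist_inf0// fine0 min_l ?mul0r// ltW.
- move=> x Bx; rewrite min_r ?divff ?gt_eqF// leNgt; apply/negP => dc.
  have : (edist_inf A' (x : T') < c%:E)%E by rewrite -(fineK (dfin x)) lte_fin.
  move=> /ereal_inf_lt [_ [z Az <-] /edist_lt_ball /= xz].
  by apply: (cAB z x) => //; exact: ball_sym.
- move=> e e0; pose D := [set xy : T' * T' | ball xy.1 (e * c) xy.2].
  have ec0 : 0 < e * c by rewrite mulr_gt0.
  have eD : @entourage T' D by rewrite -entourage_ballE; exists (e * c).
  exists D; first exact: gauge.gauge_ent eD.
  move=> x y /= Dxy; rewrite -mulrBl normrM (gtr0_norm (x := c^-1)) ?invr_gt0//.
  rewrite ler_pdivrMr//; apply: le_trans (dist_min_le _ _ _) _.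
  have xy := dlip x y _ ec0 Dxy; have yx := dlip y x _ ec0 (ball_sym Dxy).
  by rewrite ler_norml; apply/andP; split; lra.
Qed.

End Urysohn.

Section RightUniform.
Variables (R : realType) (G : topologicalGroupType).
Local Open Scope ring_scope.

Definition right_uniformly_continuous (f : G -> R) :=
  forall e, 0 < e -> exists2 V, nbhs (1%g : G) V &
    forall v x, V v -> `|f (v * x)%g - f x| <= e.

(** The hypothesis says that [U A N] misses [B]. A Urysohn function on [G/N], composed with the
    projection, is right uniformly continuous by the form of the entourages of [G/N]. *)
Lemma right_uniform_urysohn (N : subgroup G) (A B U : set G) :
  nbhs (1%g : G) U ->
  (forall a u h, A a -> U u -> subgroup_set N h -> ~ B (u * a * h)%g) ->
  exists f : G -> R, [/\ forall x, 0 <= f x <= 1,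
    forall x, A x -> f x = 0, forall x, B x -> f x = 1,
    right_uniformly_continuous f &
    forall x h, subgroup_set N h -> f (x * h)%g = f x].
Proof.
move=> nU AB; pose Q := coset_space N.
pose p : G -> Q := \pi_Q%qT.
have pE x y : p x = p y <-> subgroup_set N (x^-1 * y)%g by exact: coset_eqP.
pose E := [set (p x, p (u * x)%g) | x in [set: G] & u in U].
have eE : @entourage Q E by exists U.
have [|f [f01 fA fB fc]] := @uniform_urysohn R Q (p @` A) (p @` B) E eE.
  rewrite -subset0 => -[_ _] [[/= [a Aa <-] [b Bb <-]]].
  move=> [x _ [u Uu [xa ub]]]; apply: (AB a u (a^-1 * u^-1 * b)%g Aa Uu).
    rewrite -invgM; apply/pE; rewrite -ub.
    exact: coset_mull.
  by rewrite -invgM mulVKg.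
exists (f \o p); split=> /=.
- by move=> x; exact: f01.
- by move=> x Ax; apply: fA; exists x.
- by move=> x Bx; apply: fB; exists x.
- move=> e e0; have [D [V nV VD] De] := fc e e0; exists V => // v x Vv.
  by rewrite distrC; apply: De; apply: VD; exists x => //; exists v.
- by move=> x h Nh; congr f; apply/esym/pE; rewrite mulKg.
Qed.

End RightUniform.

Section TranslationFlow.
Variables (R : realType) (G : topologicalGroupType) (X : flow G).
Variables (I : choiceType) (f : I -> G -> R).
Local Notation FT := {ptws (I * G)%type -> R}.
Local Notation T := (X * FT)%type.

(** Moving the argument on the right gives a left action, and the value at [1] after acting by [g]
    is the former value at [g]. *)
Definition translate (g : G) (z : T) : T :=
  (gact g z.1, fun ih => z.2 (ih.1, ih.2 * g)).

(** Each modulus of right uniform continuity of [f i] also serves for [F]. This survives translation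
    and pointwise limits, and makes the action jointly continuous. *)
Definition dominated (F : FT) := forall i,
  (forall x, 0 <= F (i, x) <= 1)%R /\
  forall (e : R) v, (forall x, `|f i (v * x)%g - f i x| <= e)%R ->
    forall x, (`|F (i, (v * x)%g) - F (i, x)| <= e)%R.

Lemma dominated_closed : closed dominated.
Proof.
have ev (i : I) (x : G) : continuous (fun F : FT => F (i, x)).
  by move=> F; exact: eval_continuous.
rewrite (_ : dominated =
    \bigcap_i (\bigcap_x (fun F : FT => F (i, x)) @^-1` [set` `[0, 1]%R] `&`
      \bigcap_(ev in [set ev : R * G |
          forall x, (`|f i (ev.2 * x)%g - f i x| <= ev.1)%R]) \bigcap_x
        (fun F : FT => `|F (i, (ev.2 * x)%g) - F (i, x)|%R) @^-1`
          [set y | (y <= ev.1)%R])).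
  apply: closed_bigI => i _; apply: closedI.
    apply: closed_bigI => x _; have /continuous_closedP := ev i x; apply.
    exact: itv_closed.
  apply: closed_bigI => -[e v] _; apply: closed_bigI => x _.
  have c : continuous (fun F : FT => `|F (i, (v * x)%g) - F (i, x)|%R).
    move=> F; apply: (@continuous_comp FT R R
      (fun F => F (i, (v * x)%g) - F (i, x))%R (fun y => `|y|%R)).
      by apply: (@cvgB R R FT (nbhs F)); [exact: ev|exact: ev].
    exact: norm_continuous.
  by have /continuous_closedP := c; apply; exact: closed_le.
apply/seteqP; split=> [F dF i _|F dF i].
  split=> [x _|[e v] /= fv x _]; last exact: (dF i).2.
  by rewrite /= in_itv /=; exact: (dF i).1.
have [d1 d2] := dF i Logic.I; split=> [x|e v fv x].
  by have := d1 x Logic.I; rewrite /= in_itv.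
exact: (d2 (e, v) fv x Logic.I).
Qed.

(** The factor [X] lets [Z] tie function values to points of [X]. For joint continuity, [F (h g)]
    and [F' (h k)] are compared through [F' (h g)]: pointwise convergence handles the change of
    function, the modulus of [f i] the change of argument. *)
Lemma translation_flow (Z : set T) :
  (forall i, right_uniformly_continuous (f i)) ->
  Z !=set0 -> closed Z -> (forall z, Z z -> dominated z.2) ->
  (forall g z, Z z -> Z (translate g z)) ->
  exists (Y : flow G) (j : Y -> T),
    [/\ continuous j, injective j, range j = Z,
        forall g y, j (gact g y) = translate g (j y) &
        forall E, entourage E -> exists2 D, entourage D &
          forall x y, D (j x, j y) -> E (x, y)].
Proof.
move=> fu Zn cZ Zd Zt; apply: subflow_exists => //.
- have := compact_setX (@flow_compact _ X)
    (@ptws_compact (I * G)%type R [set` `[0, 1]%R] (@segment_compact _ _ _)).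
  move=> cB; apply: (subclosed_compact cZ cB) => -[x F] /Zd ZF.
  split=> // -[i h] /=.
  by rewrite in_itv /=; exact: (ZF i).1.
- apply: pair_hausdorff; first exact: flow_hausdorff.
  by apply: ptws_hausdorff; exact: norm_hausdorff.
- move=> [x F] _; rewrite /translate gact1; congr (_, _).
  by apply/funext => -[i h]; rewrite /= mulg1.
- move=> g h [x F] _; rewrite /translate gactM /=; congr (_, _).
  by apply/funext => -[i k]; rewrite /= mulgA.
move=> g [x F] B ZxF nB.
pose W := within [set p : G * T | Z p.2] (nbhs (g, (x, F))).
suff : (fun p => translate p.1 p.2) @ W --> translate g (x, F) by exact.
have c1 : {for (g, (x, F)), continuous (fun p : G * T => gact p.1 p.2.1)}.
  apply: (@continuous_comp (G * T)%type (G * X)%type X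
    (fun p => (p.1, p.2.1)) (fun p => gact p.1 p.2)); last first.
    exact: gact_continuous.
  apply: cvg_pair; first exact: cvg_fst.
  apply: (@continuous_comp _ T X snd fst); first exact: cvg_snd.
  exact: cvg_fst.
apply: (@cvg_pair _ _ _ W (nbhs (gact g x))
  (nbhs ((fun ih => F (ih.1, ih.2 * g)) : FT)) _ _ _ (fun p => gact p.1 p.2.1)
  (fun p => (fun ih => p.2.2 (ih.1, ih.2 * p.1)) : FT)).
  move=> C nC; have := c1 C nC.
  by apply: (@filterS _ (nbhs (g, (x, F)))) => p Cp _.
apply: ptws_cvg => -[i h] /=.
have cF : {for (g, (x, F)), continuous (fun p : G * T => p.2.2 (i, h * g))}.
  apply: (@continuous_comp _ T R snd (fun z => z.2 (i, h * g))).
    exact: cvg_snd.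
  apply: (@continuous_comp _ FT R snd (fun z => z (i, h * g))).
    exact: cvg_snd.
  exact: eval_continuous.
apply/cvgrPdist_le => e e0; have e20 : (0 < e / 2)%R by rewrite divr_gt0.
have [V nV fV] := fu i _ e20.
(* Left multiplication by [h k (h g)^-1], which is near [1], carries [h g] to [h k]. *)
have nV' : nbhs g [set k | V (h * k * (h * g)^-1)].
  have nV1 : nbhs (h * g * (h * g)^-1) V by rewrite mulgV.
  have := @mulgr_continuous G (h * g)^-1 (h * g) V nV1.
  move=> nV2; have := @mulg_continuous G (h, g) _ nV2.
  move=> [[V1 V2] /= [n1 n2] V12]; apply: filterS n2 => k V2k.
  exact: (V12 (h, k) (conj (nbhs_singleton n1) V2k)).
have n1 : nbhs (g, (x, F)) [set p : G * T | V (h * p.1 * (h * g)^-1)].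
  exact: (@cvg_fst _ _ (nbhs g) (nbhs (x, F))) nV'.
have n2 : nbhs (g, (x, F)) [set p : G * T |
    `|F (i, (h * g)%g) - p.2.2 (i, (h * g)%g)| <= e / 2]%R.
  by have /cvgrPdist_le := cF; exact.
rewrite /within /=; near_simpl.
apply: filterS (filterI n1 n2) => -[k [y F']] /= [Vk dF] ZF'.
have [_ dd] := Zd _ ZF' i.
have := dd _ _ (fun x => fV _ x Vk) (h * g); rewrite mulgVK => d2.
rewrite distrC /= in d2.
by apply: le_trans (ler_distD (F' (i, h * g)) _ _) _; lra.
Qed.

End TranslationFlow.

(** * Open sets that a neighborhood of the identity must connect *)

Lemma is_subgroup1 (G : groupType) : is_subgroup [set 1 : G].
Proof.
by split=> [//|x y -> ->|x ->] /=; [rewrite mulg1|rewrite invg1].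
Qed.

(** Otherwise every nonempty open set contains two nonempty open sets that [U] does not connect.
    Repeated splitting gives the sets [O n], and factors of [M] then see too many functions for a
    countable base. The lemma serves to prove almost openness of the orbit map. *)
Lemma somewhere_meeting (R : realType) (G : topologicalGroupType)
    (M X : flow G) (U : set G) :
  universal_minimal_flow M -> countably_based M -> minimal X ->
  nbhs (1 : G) U ->
  exists W : set X, [/\ open W, W !=set0 & forall W1 W2 : set X,
    open W1 -> open W2 -> W1 !=set0 -> W2 !=set0 -> W1 `<=` W -> W2 `<=` W ->
    exists u x, [/\ U u, W1 x & W2 (gact u x)]].
Proof.
move=> [_ _ uM] [P [oP PP]] mX nU; apply: contrapT => noW.
pose st := {N : set X | open N /\ N !=set0}.
have step (N : st) : exists ON : st * st,
    [/\ sval ON.1 `<=` sval N, sval ON.2 `<=` sval N &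
        forall u x, U u -> sval ON.1 x -> ~ sval ON.2 (gact u x)].
  apply: contrapT => noON; apply: noW; case: N noON => N [oN Nn] /= noON.
  exists N; split=> // W1 W2 o1 o2 n1 n2 W1N W2N; apply: contrapT => no.
  apply: noON; exists (exist _ W1 (conj o1 n1), exist _ W2 (conj o2 n2)).
  by split=> //= u x Uu W1x W2x; apply: no; exists u, x.
have [F FP] := choice step.
have [x0 _] := @flow_nonempty _ X.
(* At each stage the first piece is kept as [O n] and the second is split further, so every later
   [O k] lies in a set that [U] does not reach from [O n]. *)
pose s := fix s n : st :=
  if n is k.+1 then (F (s k)).2 else
    exist _ setT (conj openT (ex_intro setT x0 Logic.I)).
pose O n := sval (F (s n)).1.
have oO n : open (O n) by case: (svalP (F (s n)).1).
have On n : O n !=set0 by case: (svalP (F (s n)).1).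
have sS n k : (n < k)%N -> O k `<=` sval (s n.+1).
  move=> nk x Okx.
  have {Okx} : sval (s k) x by have [H _ _] := FP (s k); exact: H.
  elim: k nk => // k IH; rewrite ltnS leq_eqVlt => /predU1P[->//|nk].
  by move=> skx; apply: (IH nk); have [_ H _] := FP (s k); exact: H.
(* The construction separates earlier sets from later ones; symmetry of [V] gives the other
   order. *)
pose V := U `&` (fun u => u^-1) @^-1` U.
have nV : nbhs (1 : G) V.
  by apply: filterI => //; apply: invg_continuous; rewrite invg1.
have sep n k u x : n != k -> V u -> O n x -> ~ O k (gact u x).
  rewrite neq_ltn => /orP[nk|kn] [Uu UVu] Onx Okx.
    by have [_ _] := FP (s n); move=> /(_ u x Uu Onx); apply; exact: sS Okx.
  have [_ _] := FP (s k); move=> /(_ u^-1 (gact u x) UVu Okx); apply.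
  by rewrite gactK; exact: sS Onx.
pose A (S : set nat) := [set g : G | exists2 n, S n & O n (gact g x0)].
have /choice [f fP] : forall S : set nat, exists f : G -> R,
    [/\ forall x, (0 <= f x <= 1)%R, forall x, A S x -> f x = 0%R,
        forall x, A (~` S) x -> f x = 1%R & right_uniformly_continuous f].
  move=> S; have [|f [f01 f0 f1 fu _]] := @right_uniform_urysohn R G
      (Subgroup (is_subgroup1 G)) (A S) (A (~` S)) V nV.
    move=> a u h [n Sn Ona] Vu /= -> [k Sk]; rewrite mulg1 gactM.
    by apply: (sep n k) => //; apply/eqP => nk; apply: Sk; rewrite -nk.
  by exists f; split.
pose FT := {ptws (set nat * G)%type -> R}.
pose c (S : set nat) n : R := if `[< S n >] then 0%R else 1%R.
(* Wherever [h] moves the point into [O n], the function of [S] must take at [h] the value telling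
   whether [n] is in [S]. The condition is closed because [O n] is open, and it is invariant. *)
pose Z2 := [set z : X * FT |
  forall S n h, O n (gact h z.1) -> z.2 (S, h) = c S n].
pose Z := (snd : X * FT -> FT) @^-1` dominated f `&` Z2.
have cev (a : set nat * G) : continuous (fun z : X * FT => z.2 a).
  move=> z; apply: (@continuous_comp (X * FT)%type FT R snd (fun F => F a)).
    exact: cvg_snd.
  exact: eval_continuous.
have closed_pt (r : R) : closed [set r].
  apply: accessible_closed_set1; apply: hausdorff_accessible.
  exact: norm_hausdorff.
have cZ : closed Z.
  apply: closedI.
    have /continuous_closedP : continuous (@snd X FT).
      by move=> z; exact: cvg_snd.
    by apply; exact: dominated_closed.
  rewrite (_ : Z2 = \bigcap_S \bigcap_n \bigcap_h
     (~` ((fun z : X * FT => gact h z.1) @^-1` O n) `|`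
      (fun z : X * FT => z.2 (S, h)) @^-1` [set c S n])); last first.
    apply/seteqP; split=> [z zP S _ n _ h _|z zP S n h Oz].
      by have [Oz|] := pselect (O n (gact h z.1)); [right; exact: zP|left].
    by have [] := zP S Logic.I n Logic.I h Logic.I.
  apply: closed_bigI => S _; apply: closed_bigI => n _.
  apply: closed_bigI => h _.
  apply: closedU; last by have /continuous_closedP := cev (S, h); apply.
  apply: open_closedC.
  have /continuousP : continuous (fun z : X * FT => gact h z.1).
    move=> z; apply: (@continuous_comp (X * FT)%type X X fst (gact h)).
      exact: cvg_fst.
    exact: gact_continuousr.
  exact.
have Zn : Z !=set0.
  exists (x0, fun Sh => f Sh.1 Sh.2); split=> /=.
    by move=> S; split=> // x; have [] := fP S.
  move=> S n h Oh; rewrite /c; have [_ f0 f1 _] := fP S.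
  by case: asboolP => Sn; [apply: f0|apply: f1]; exists n.
have Zt g z : Z z -> Z (translate g z).
  move=> [dz Oz]; split=> [S|S n h] /=.
    split=> [x|e v fv x]; first exact: (dz S).1.
    by rewrite -mulgA; exact: (dz S).2.
  by rewrite -gactM; exact: Oz.
have [||Y [j [cj ij rj ej _]]] :=
  @translation_flow R G X (set nat) f Z _ Zn cZ _ Zt.
- by move=> S; have [] := fP S.
- by move=> z [].
have [Y' [i [ci ei ii mY']]] := minimal_subflow Y.
have [q [cq eq _]] := uM Y' Logic.I mY'.
pose w (y : M) := j (i (q y)).
have cw : continuous w.
  move=> y; apply: (@continuous_comp M Y' (X * FT)%type q (j \o i)).
    exact: cq.
  by apply: continuous_comp; [exact: ci|exact: cj].
have Zw y : Z (w y) by rewrite -rj; exists (i (q y)).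
have sw : range (fst \o w) = [set: X].
  apply: minimal_onto => //.
    move=> y; apply: (@continuous_comp M (X * FT)%type X w fst).
      exact: cw.
    exact: cvg_fst.
  by move=> g y; rewrite /w /= eq ei ej.
(* [y n] is a point of [M] over [O n], so the function of [S], evaluated at [1], tells there whether
   [n] is in [S]. *)
have /choice [y yP] : forall n, exists y, O n (w y).1.
  move=> n; have [x Ox] := On n.
  have [y _ yx] : range (fst \o w) x by rewrite sw.
  by exists y; rewrite -yx in Ox.
have wc S n : (w (y n)).2 (S, 1) = c S n.
  by apply: (Zw (y n)).2; rewrite gact1.
have cwS S : continuous (fun y => (w y).2 (S, 1)).
  move=> z; apply: (@continuous_comp M (X * FT)%type R w (fun z => z.2 (S, 1))).
    exact: cw.
  exact: cev.
(* [P] would separate every set of indices from its complement: apply Cantor's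
   diagonal argument. *)
pose S := [set n | ~ P n (y n)].
have [|||k [Pk kP]] := PP ((fun y => (w y).2 (S, 1)) @^-1` [set 0%R])
    ((fun y => (w y).2 (S, 1)) @^-1` [set r | (r < 1)%R]).
- by have /continuous_closedP := cwS S; apply.
- by have /continuousP := cwS S; apply; exact: open_lt.
- by move=> z /= ->; exact: ltr01.
have [Sk|nSk] := pselect (S k).
  by apply: (Sk); apply: Pk; rewrite /= wc /c; case: asboolP.
apply: (nSk) => Pyk; have := kP _ Pyk; rewrite /= wc /c.
by case: asboolP => //; rewrite ltxx.
Qed.

(** * The orbit of the identity *)

Section GroupFlowOrbit.
Variables (G : topologicalGroupType) (K : flow G).
Variables (m : K -> K -> K) (e : K) (i : K -> K).
Hypothesis gfK : group_flow m e i.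

Let mA : associative m. Proof. by case: gfK. Qed.
Let me1 : left_id e m. Proof. by case: gfK. Qed.
Let mV : left_inverse e i m. Proof. by case: gfK. Qed.
Let cR : forall q, continuous (m^~ q). Proof. by case: gfK. Qed.
Let gm : forall g p, gact g p = m (gact g e) p. Proof. by case: gfK. Qed.
Let m1 : right_id e m. Proof. exact: group_flow_mul1 gfK. Qed.
Let mVr : right_inverse e i m. Proof. exact: group_flow_mulV gfK. Qed.

Lemma group_flow_mulI (p q r : K) : m p r = m q r -> p = q.
Proof. by move=> pq; rewrite -[p]m1 -(mVr r) mA pq -mA mVr m1. Qed.

(** Right cancellation, since the hypothesis reads [m (gact g e) p = m e p]. *)
Lemma group_flow_fix (g : G) (p : K) : gact g p = p -> gact g e = e.
Proof. by move=> gp; apply: (@group_flow_mulI _ _ p); rewrite -gm me1. Qed.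

Lemma group_flow_stabilizer : is_subgroup [set g : G | gact g e = e].
Proof.
split=> [|g h /= ge he|g /= ge] /=; first by rewrite gact1.
  by rewrite gactM he.
by rewrite -[in LHS]ge gactK.
Qed.

Definition stabilizer : subgroup G := Subgroup group_flow_stabilizer.

Lemma stabilizer_act g (p : K) : subgroup_set stabilizer g -> gact g p = p.
Proof. by move=> /= ge; rewrite gm ge me1. Qed.

Lemma stabilizer_closed : closed (stabilizer : set G).
Proof.
have /continuous_closedP := @gact_continuousl G K e.
move=> /(_ [set e]); apply; apply: accessible_closed_set1.
by apply: hausdorff_accessible; exact: flow_hausdorff.
Qed.

Section Open.
Variables (R : realType) (M : flow G).
Hypotheses (polG : polish R G) (uM : universal_minimal_flow M).
Hypotheses (baseM : countably_based M) (minK : minimal K).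
Hypothesis baseK : countably_based K.

(** For [z] near [e], both [w] and [m z w] lie in [W], so some [u] in [V] moves a point [x] near [w]
    to a point near [m z w]. Dividing by [x] shows that [gact u e] is near [z]. *)
Lemma group_flow_almost_open (g : G) (U : set G) : nbhs g U ->
  nbhs (gact g e) (closure [set gact u e | u in U]).
Proof.
move=> nU; pose V := [set u | U (u * g)].
have nV : nbhs (1 : G) V.
  by have := @mulgr_continuous G g 1 U; rewrite mul1g; apply.
have [W [oW [w Ww] WP]] := somewhere_meeting R uM baseM minK nV.
have eV : nbhs e (closure [set gact u e | u in V]).
  apply: (@filterS _ (nbhs e) _ ((m^~ w) @^-1` W)); last first.
    by apply: (@cR w); rewrite /= me1; apply: open_nbhs_nbhs.
  move=> z Wz B nB.
  have c : {for (w, m z w), continuous (fun pq : K * K => m pq.2 (i pq.1))}.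
    apply: (@continuous_comp (K * K)%type (K * K)%type K
      (fun pq => (pq.2, i pq.1)) (fun pq => m pq.1 pq.2)); last first.
      exact: (group_flow_continuous gfK).
    apply: cvg_pair; first exact: cvg_snd.
    apply: (@continuous_comp _ K K fst i); first exact: cvg_fst.
    exact: (group_flow_inv_continuous gfK).
  have nB' : nbhs (m (m z w) (i w)) B by rewrite -mA mVr m1.
  have [[W1 W2] /= [n1 n2] W12] := c _ nB'.
  have [||||||u [x [Vu [W1x _] [W2ux _]]]] := WP (W1° `&` W) (W2° `&` W).
  - by apply: openI => //; exact: open_interior.
  - by apply: openI => //; exact: open_interior.
  - by exists w; split=> //; exact: nbhs_singleton (nbhs_interior n1).
  - by exists (m z w); split=> //; exact: nbhs_singleton (nbhs_interior n2).
  - by move=> x [].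
  - by move=> x [].
  exists (gact u e); split; first by exists u.
  have := W12 (x, gact u x) (conj (interior_subset W1x) (interior_subset W2ux)).
  by rewrite /= gm -mA mVr m1.
(* Right translation carries the statement from [e] to [gact g e]. *)
have : nbhs (gact g e)
    ((m^~ (i (gact g e))) @^-1` closure [set gact u e | u in V]).
  by apply: (@cR (i (gact g e))); rewrite /= mVr.
apply: (@filterS _ (nbhs (gact g e))) => p /= pV B nB.
have nB' : nbhs (m p (i (gact g e))) ((m^~ (gact g e)) @^-1` B).
  by apply: (@cR (gact g e)); rewrite /= -mA mV m1.
have [_ [[u Vu <-] Bu]] := pV _ nB'.
exists (gact (u * g) e); split; first by exists (u * g).
by rewrite gactM gm.
Qed.

(** A Pettis argument: near [y], both the image of [V] and its left translate by [y] are comeagre,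
    so some [w = gact v e] satisfies [y^-1 w = gact v' e], and [y = gact (v v'^-1) e]. *)
Lemma group_flow_open (U : set G) : nbhs (1 : G) U ->
  nbhs e [set gact u e | u in U].
Proof.
move=> nU.
have [|C [cC C0 CP]] := almost_open_comeagre polG (1 : G) (@flow_hausdorff _ K)
    (@gact_continuousl G K e).
  by move=> g V; exact: group_flow_almost_open.
have [V nV VU] : exists2 V, nbhs (1 : G) V &
    forall u v, V u -> V v -> U (u * v^-1).
  have c : {for (1, 1), continuous (fun uv : G * G => uv.1 * uv.2^-1)}.
    apply: (@continuous_comp (G * G)%type (G * G)%type G
      (fun uv => (uv.1, uv.2^-1)) (fun uv => uv.1 * uv.2)); last first.
      exact: mulg_continuous.
    apply: cvg_pair; first exact: cvg_fst.
    apply: (@continuous_comp _ G G snd (fun v => v^-1)); first exact: cvg_snd.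
    exact: invg_continuous.
  have nU' : nbhs ((1 : G) * 1^-1) U by rewrite invg1 mulg1.
  have [[V1 V2] /= [n1 n2] V12] := c _ nU'.
  exists (V1 `&` V2); first exact: filterI.
  by move=> u v [V1u _] [_ V2v]; exact: (V12 (u, v)).
have nW := CP 1 V nV; rewrite gact1 in nW.
set S := [set y | _] in nW.
apply: filterS (nbhs_interior nW) => y Wy.
pose L := m (i y).
have cL q : continuous (m q) by exact: (group_flow_continuousl gfK).
pose O := S° `&` L @^-1` S°.
have oO : open O.
  apply: openI; first exact: open_interior.
  have /continuousP := cL (i y); apply; exact: open_interior.
have Oy : O y.
  by split=> //=; rewrite /L mV; exact: nbhs_singleton (nbhs_interior nW).
(* One family holds the nowhere dense sets and their left translates by [y], so that a single use of
   Baire's theorem avoids both. *)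
pose C' (bj : bool * (nat * nat * nat)) :=
  if bj.1 then L @^-1` C bj.2 else C bj.2.
have [|w [/interior_subset Sw /interior_subset SLw] wC] :=
    @baire_closed_count _ K C' O (@flow_compact _ K) (@flow_hausdorff _ K) _ oO
      (ex_intro _ y Oy).
  move=> [[] j] /=; last exact: cC.
  by have /continuous_closedP := cL (i y); apply; exact: cC.
have [v Vv vw] : [set gact u e | u in V] w.
  by apply: Sw => j Cw; have := wC (false, j) Cw; rewrite /= C0.
have [v' Vv' vw'] : [set gact u e | u in V] (L w).
  apply: SLw => j Cw; have := wC (true, j) Cw => /= Iw.
  suff : (C j)° (L w) by rewrite C0.
  rewrite /interior; apply: (@filterS _ (nbhs (L w)) _
    ((m y) @^-1` (L @^-1` C j))).
    by move=> z /=; rewrite /L mA mV me1.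
  by apply: cL; rewrite /L mA mVr me1.
exists (v * v'^-1); first exact: VU.
apply: (@group_flow_mulI _ _ (gact v' e)).
rewrite -gm -gactM mulgVK vw vw' /L mA mVr me1.
by [].
Qed.

(** The orbit of [e] is a neighborhood of [e], so the dense orbit of [k] meets it. *)
Lemma group_flow_transitive (k : K) : exists g, gact g e = k.
Proof.
have nT : nbhs (1 : G) setT by exact: filterT.
have ne := nbhs_interior (group_flow_open nT).
have [z [/interior_subset [h _ hz] [g _ gk]]] :=
  minK k (ex_intro _ e (nbhs_singleton ne)) (@open_interior _ _).
by exists (g^-1 * h); rewrite gactM hz -gk gactK.
Qed.

(** Continuity of the inverse is openness of the orbit map at [e], moved to [k] by a right
    translation. *)
Lemma group_flow_coset : exists f : coset_gspace stabilizer -> K,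
  homeomorphism f /\ equivariant f.
Proof.
pose p : G -> coset_space stabilizer := \pi_(coset_space stabilizer)%qT.
have pE x y : p x = p y <-> gact x e = gact y e.
  rewrite /p coset_eqP /= gactM; split=> [xy|<-]; last by rewrite gactK.
  by rewrite -[RHS](gactKV x) xy.
pose f (q : coset_space stabilizer) : K := gact (repr q) e.
have fp x : f (p x) = gact x e by apply/pE; rewrite /p reprK.
have cf : continuous f.
  move=> q; have [x ->] := cosetW q => A.
  rewrite -/(p x) fp => nA.
  have := coset_pi_nbhs stabilizer (@gact_continuousl G K e x A nA).
  apply: (@filterS _ (nbhs (p x))) => _ [y Ay <-].
  by rewrite /= -/(p y) fp.
have /choice [s sP] := group_flow_transitive.
pose g k := p (s k).
have fg : cancel g f by move=> k; rewrite /g fp.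
have gf : cancel f g.
  by move=> q; have [x ->] := cosetW q; apply/pE; rewrite sP -/(p x) fp.
exists f; split; last first.
  move=> h q; have [x ->] := cosetW q.
  by rewrite /gact /= coset_actE -!/(p _) !fp gactM.
split=> //; exists g; split=> // k A nA.
have nV : nbhs (1 : G) [set u | A (p (u * s k))].
  have nA' : nbhs (1 * s k) (p @^-1` A).
    by rewrite mul1g; exact: (@coset_pi_continuous G stabilizer (s k)).
  exact: mulgr_continuous nA'.
have nk : nbhs (m k (i k)) [set gact u e | u in [set u | A (p (u * s k))]].
  by rewrite mVr; exact: group_flow_open.
have := @cR (i k) k _ nk; apply: (@filterS _ (nbhs k)) => l /= [u Au ul].
suff -> : g l = p (u * s k) by [].
apply/pE; rewrite sP gactM sP; apply: (@group_flow_mulI _ _ (i k)).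
by rewrite -ul (gm u k) -mA mVr m1.
Qed.

(** [X] is the orbit of [f e], so right cancellation in [K] makes [f'] injective; transitivity makes
    it onto. *)
Lemma group_flow_iso (X : flow G) (f : K -> X) (f' : X -> K) :
  equivariant f -> range f = [set: X] -> continuous f' -> equivariant f' ->
  gspace_iso X K.
Proof.
move=> ef sf cf' ef'; exists f'; split=> //.
have fK x : exists g, x = gact g (f e).
  have [k _ <-] : range f x by rewrite sf.
  by have [g <-] := group_flow_transitive k; exists g; rewrite ef.
apply: continuous_bij_homeo => //.
- exact: flow_compact.
- exact: flow_hausdorff.
- move=> x y; have [g ->] := fK x; have [h ->] := fK y.
  rewrite !ef' gm [RHS]gm => /group_flow_mulI gh.
  by rewrite -!ef gh.
apply/seteqP; split=> // k _.
have [g gk] := group_flow_transitive (m k (i (f' (f e)))).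
by exists (gact g (f e)) => //; rewrite ef' gm gk -mA mV m1.
Qed.

End Open.
End GroupFlowOrbit.

(** * The closed normal closure *)

Lemma subgroup_eq (G : groupType) (A B : subgroup G) :
  (A : set G) = B -> A = B.
Proof.
by case: A B => A sA [B sB] /= AB; rewrite AB in sA *; congr Subgroup.
Qed.

Section NormalClosure.
Variables (G : topologicalGroupType) (H : subgroup G).
Local Notation N := (closed_normal_closure H).

Lemma closed_normal_closure_closed : closed (N : set G).
Proof. exact: closed_closure. Qed.

Lemma closed_normal_closure_sub (A : subgroup G) :
  closed (A : set G) ->
  (forall g h, subgroup_set H h -> subgroup_set A (g * h * g^-1)) ->
  subgroup_set N `<=` subgroup_set A.
Proof.
move=> cA HA; rewrite [X in _ `<=` X](closure_id _).1 //; apply: closureS.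
move=> x; apply; split; first exact: subgroupP.
by move=> _ [g _ [h Hh <-]]; exact: HA.
Qed.

Lemma closed_normal_closureS : subgroup_set H `<=` subgroup_set N.
Proof.
move=> h Hh; apply: subset_closure => B [_ HB]; apply: HB.
by exists 1 => //; exists h => //; rewrite invg1 mulg1 mul1g.
Qed.

(** The elements conjugated into [N] by [g] form a closed subgroup containing the generators. *)
Lemma closed_normal_closureJ g x :
  subgroup_set N x -> subgroup_set N (g * x * g^-1).
Proof.
pose B := [set x | subgroup_set N (g * x * g^-1)].
have c : continuous (fun x => g * x * g^-1).
  move=> y.
  apply: (@continuous_comp G G G (fun x => g * x) (fun x => x * g^-1)).
    apply: (@continuous_comp G (G * G)%type G (fun z => (g, z))
      (fun p => p.1 * p.2)); last exact: mulg_continuous.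
    exact: (cvg_pair (cvg_cst g) cvg_id).
  exact: mulgr_continuous.
have cB : closed B.
  by have /continuous_closedP := c; apply; exact: closed_normal_closure_closed.
suff NB : subgroup_set N `<=` B by exact: NB.
rewrite [X in _ `<=` X](closure_id _).1 //; apply: closureS => y.
have [N1 NM NV] := subgroupP N.
apply; split; first split.
- by rewrite /B /= mulg1 mulgV.
- move=> a b Ba Bb; rewrite /B /=; have := NM _ _ Ba Bb.
  by rewrite !mulgA mulgVK.
- move=> a Ba; rewrite /B /=; have := NV _ Ba.
  by rewrite !invgM invgK mulgA.
move=> _ [k _ [h Hh <-]]; apply: subset_closure => C [_ HC]; apply: HC.
by exists (g * k) => //; exists h => //; rewrite invgM !mulgA.
Qed.

End NormalClosure.

(** * Precompactness and almost periodic functions *)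

Section Precompact.
Variables (G : topologicalGroupType) (H : subgroup G) (M : flow G).
Hypothesis HM : is_coset_completion H M.

(** Finitely many entourage sections at points of the dense image of [G/H] cover the compact
    completion. *)
Lemma coset_completion_precompact (U : set G) : nbhs (1 : G) U ->
  exists s : seq G, forall x, exists y u h,
    [/\ y \in s, U u, subgroup_set H h & x = u * y * h].
Proof.
move=> nU; have [j [[_ _ dj uj] _]] := HM.
pose p : G -> coset_space H := \pi_(coset_space H)%qT.
pose E := [set (p x, p (u * x)) | x in [set: G] & u in U].
have [D eD DE] : exists2 D : set (M * M), entourage D &
    [set q | D (j q.1, j q.2)] `<=` E.
  by apply/uj; exists U.
have [||s _ sP] := @compact_finite_cover M G setT
    (fun x => (xsection D (j (p x)))°) (@flow_compact _ M).
- by move=> x _; exact: open_interior.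
- move=> c; pose S := split_ent D.
  have eS : entourage S by exact: entourage_split_ent.
  have nS : nbhs c (xsection (S^-1)%relation c).
    by apply: nbhs_entourage; exact: entourage_inv.
  have Sc := nbhs_singleton (nbhs_interior nS).
  have [d [Sd [q _ qd]]] := dj _ (ex_intro _ c Sc) (@open_interior _ _).
  have [x qx] := cosetW q; exists x => //.
  have Sxc : S (j (p x), c).
    by move: (interior_subset Sd); rewrite -qd qx => /xsectionP.
  apply: (@filterS _ (nbhs c) _ (xsection S c)); last exact: nbhs_entourage.
  move=> c' /xsectionP Scc'; apply/xsectionP.
  exact: (entourage_split c).
exists s => x; have [y ys yx] := sP (j (p x)).
have Dyx : D (j (p y), j (p x)) by apply/xsectionP; exact: interior_subset yx.
have [z _ [u Uu [zy zx]]] := DE (p y, p x) Dyx.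
have px : p (u * y) = p x by rewrite -zx; apply/esym/coset_mull.
exists y, u, ((u * y)^-1 * x); split=> //; last by rewrite mulVKg.
exact: (coset_eqP H (u * y) x).1.
Qed.

End Precompact.

(* Precompactness of [G/H] makes the [N]-invariant right uniformly continuous
   functions almost periodic. *)
Lemma equicontinuous_flow_moving (R : realType) (G : topologicalGroupType)
    (H : subgroup G) (M X : flow G) (g : G) :
  is_coset_completion H M -> equicontinuous_action X ->
  ~ subgroup_set (closed_normal_closure H) g ->
  exists (Y : flow G) (y : Y),
    [/\ equicontinuous_action Y, minimal Y & gact g y <> y].
Proof.
move=> HM eX Ng; set N := closed_normal_closure H in Ng *.
(* Since [N] is closed, [U N] misses [g] for small [U]; this gives an [N]-invariant [f] with
   [f 1 = 0] and [f g = 1]. *)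
have [U nU UN] : exists2 U, nbhs (1 : G) U &
    forall u n, U u -> subgroup_set N n -> u * n <> g.
  exists [set u | ~ subgroup_set N (u^-1 * g)].
    have nN : nbhs g (~` (N : set G)).
      apply: open_nbhs_nbhs; split=> //; apply: closed_openC.
      exact: closed_normal_closure_closed.
    have c : {for 1, continuous (fun u : G => u^-1 * g)}.
      apply: (@continuous_comp G G G (fun u => u^-1) (fun u => u * g)).
        exact: invg_continuous.
      exact: mulgr_continuous.
    by apply: (c (~` (N : set G))); rewrite invg1 mul1g.
  by move=> u n /= Nu Nn ug; apply: Nu; rewrite -ug mulKg.
have [|f [f01 f1 fg fu fN]] :=
    @right_uniform_urysohn R G N [set 1] [set g] U nU.
  by move=> _ u n -> Uu Nn /=; rewrite mulg1; exact: UN.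
pose FT := {ptws (unit * G)%type -> R}.
pose Z2 := [set z : X * FT | forall x n, subgroup_set N n ->
  z.2 (tt, x * n) = z.2 (tt, x)].
pose Z := (snd : X * FT -> FT) @^-1` dominated (fun=> f) `&` Z2.
have cev (a : unit * G) : continuous (fun z : X * FT => z.2 a).
  move=> z; apply: (@continuous_comp (X * FT)%type FT R snd (fun F => F a)).
    exact: cvg_snd.
  exact: eval_continuous.
have cZ : closed Z.
  apply: closedI.
    have /continuous_closedP : continuous (@snd X FT).
      by move=> z; exact: cvg_snd.
    by apply; exact: dominated_closed.
  rewrite (_ : Z2 = \bigcap_x \bigcap_(n in N : set G)
     (fun z : X * FT => z.2 (tt, (x * n)%g) - z.2 (tt, x))%R @^-1`
       [set 0%R]); last first.
    apply/seteqP; split=> [z zP x _ n Nn|z zP x n Nn] /=.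
      by rewrite zP// subrr.
    by apply/eqP; rewrite -subr_eq0; apply/eqP; exact: (zP x Logic.I n Nn).
  apply: closed_bigI => x _; apply: closed_bigI => n _.
  have c : continuous (fun z : X * FT => z.2 (tt, (x * n)%g) - z.2 (tt, x))%R.
    move=> z; apply: (@cvgB R R _ (nbhs z)); exact: cev.
  have /continuous_closedP := c; apply.
  apply: accessible_closed_set1; apply: hausdorff_accessible.
  exact: norm_hausdorff.
have [x0 _] := @flow_nonempty _ X.
pose F0 : FT := fun a => f a.2.
have ZF0 : Z (x0, F0).
  split=> [i|x n Nn] /=; first by split=> // x; exact: f01.
  exact: fN.
have Zt h z : Z z -> Z (translate h z).
  move=> [dz Nz]; split=> [i|x n Nn] /=.
    split=> [x|e v fv x]; first exact: (dz i).1.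
    by rewrite -mulgA; exact: (dz i).2.
  (* Normality of [N] makes right invariance stable under translation: [x n h = x h (h^-1 n h)]. *)
  rewrite -[RHS](Nz _ (h^-1 * n * h)).
    by rewrite !mulgA mulgK.
  by have := closed_normal_closureJ (g := h^-1) Nn; rewrite invgK.
have [||Y [j [cj ij rj ej uj]]] := @translation_flow R G X unit (fun=> f) Z _
    (ex_intro _ _ ZF0) cZ _ Zt.
- by move=> _; exact: fu.
- by move=> z [].
have Zj y : Z (j y) by rewrite -rj; exists y.
have eY : equicontinuous_action Y.
  move=> y E eE; have [D eD DE] := uj E eE.
  have [[D1 D2] /= [e1 e2] D12] := eD.
  have [U1 nU1 U1P] := eX (j y).1 D1 e1.
  have [d d0 dD] := ptws_entourage e2.
  have d30 : (0 < d / 3)%R by rewrite divr_gt0.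
  have [V nV fV] := fu _ d30.
  have [s sP] := coset_completion_precompact HM nV.
  (* Every [x] is [v z n] with [z] in [s]. Invariance removes [n], removing [v] costs [d / 3] for
     each function, and closeness on [s] costs the last [d / 3]; the resulting bound is uniform on
     [G], hence stable under translation. *)
  pose near_s := [set y' : Y | forall x, x \in s ->
    (`|(j y).2 (tt, x) - (j y').2 (tt, x)| <= d / 3)%R].
  have nS : nbhs y near_s.
    apply: (@finite_near G Y y s (fun x => [set y' : Y |
      (`|(j y).2 (tt, x) - (j y').2 (tt, x)| <= d / 3)%R])) => x _.
    have c : {for y, continuous (fun y => (j y).2 (tt, x))}.
      by apply: (@continuous_comp Y (X * FT)%type R j (fun z => z.2 (tt, x)));
        [exact: cj|exact: cev].
    by have /cvgrPdist_le := c; exact.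
  exists ([set y' | U1 (j y').1] `&` near_s).
    apply: filterI => //.
    have c : {for y, continuous (fun y => (j y).1)}.
      apply: (@continuous_comp Y (X * FT)%type X j fst); first exact: cj.
      exact: cvg_fst.
    exact: c.
  have near y' : near_s y' ->
      forall x, (`|(j y).2 (tt, x) - (j y').2 (tt, x)| <= d)%R.
    move=> sy' x; have [z [v [n [zs Vv Hn ->]]]] := sP x.
    have Nn : subgroup_set N n by exact: closed_normal_closureS.
    have [[dy Ny] [dy' Ny']] := (Zj y, Zj y').
    rewrite Ny// Ny'//.
    have a1 := (dy tt).2 _ _ (fun x => fV v x Vv) z.
    have a2 := (dy' tt).2 _ _ (fun x => fV v x Vv) z.
    have a3 := sy' z zs; rewrite distrC in a2.
    apply: le_trans (ler_distD ((j y).2 (tt, z)) _ _) _.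
    have := ler_distD ((j y').2 (tt, z)) ((j y).2 (tt, z))
      ((j y').2 (tt, v * z)).
    lra.
  move=> h y' [Uy' sy']; apply: DE; rewrite !ej.
  have Dh : (D1 `*` D2) (((translate h (j y)).1, (translate h (j y')).1),
                  ((translate h (j y)).2, (translate h (j y')).2)).
    split=> /=; first exact: U1P.
    by apply: dD => -[[] x]; exact: near.
  have [[[a b] [a' b']] Dab abE] := D12 _ Dh.
  by case: abE Dab => -> -> -> ->.
have [y _ jy] : range j (x0, F0) by rewrite rj.
have [Y' [k [y' [ck ek mY' eY' ky']]]] := equicontinuous_orbit_minimal y eY.
exists Y', y'; split=> // gy'.
have : f (1 * g) = f 1.
  have := congr1 (fun y' => (j (k y')).2 (tt, 1)) gy'.
  by rewrite ek ej ky' jy.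
by rewrite mul1g fg// f1// => /eqP; rewrite oner_eq0.
Qed.

(** * Restriction to a subgroup and identification of the flows *)

Section RestrictedFlow.
Variables (G : topologicalGroupType) (K : flow G) (H : subgroup G).

Let act (s : subgroup_type H) (k : K) : K := gact (set_val s : G) k.

Let act1 k : act 1 k = k.
Proof. by rewrite /act subgroup_val1 gact1. Qed.

Let actM s t k : act (s * t) k = act s (act t k).
Proof. by rewrite /act subgroup_valM gactM. Qed.

Let act_continuous : continuous (fun p : subgroup_type H * K => act p.1 p.2).
Proof.
move=> [s k].
apply: (@continuous_comp (subgroup_type H * K)%type (G * K)%type K
  (fun p => (set_val p.1 : G, p.2)) (fun p => gact p.1 p.2)); last first.
  exact: gact_continuous.
apply: cvg_pair; last exact: cvg_snd.
apply: (@continuous_comp _ (subgroup_type H) G fst (fun s => set_val s)).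
  exact: cvg_fst.
exact: initial_continuous.
Qed.

Definition restricted_flow : flow (subgroup_type H) :=
  @Flow _ (GSpace act1 actM act_continuous) (@flow_nonempty _ K)
    (@flow_compact _ K) (@flow_hausdorff _ K).

End RestrictedFlow.

Theorem theorem3 (R : realType) (G : topologicalGroupType) (M D B : flow G) :
  polish R G ->
  universal_minimal_flow M ->
  metrizable R M ->
  universal_minimal_distal_flow D ->
  universal_minimal_equicontinuous_flow B ->
  [/\ gspace_iso D B,
      exists H : subgroup G,
        [/\ closed H, cocompact H & gspace_iso B (coset_gspace H)]
    & forall Gs : subgroup G,
        closed Gs -> coprecompact Gs -> extremely_amenable (subgroup_type Gs) ->
        is_coset_completion Gs M ->
        [/\ closed (closed_normal_closure Gs),
            cocompact (closed_normal_closure Gs)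
          & gspace_iso B (coset_gspace (closed_normal_closure Gs))]].
Proof.
move=> polG uM mM [dD mD uD] [eB mB uB].
have baseM : countably_based M.
  by apply: (metrizable_countably_based _ _ mM);
    [exact: flow_compact|exact: flow_nonempty].
have [K [m [e [i [gfK mK dK oK]]]]] := ellis_group dD.
have [q [cq eq sq]] : maps_onto M K by case: uM => _ _; apply.
have baseK : countably_based K.
  by apply: (countably_based_image _ _ cq sq baseM);
    [exact: flow_compact|exact: flow_hausdorff].
have eK : equicontinuous_action K by exact: (group_flow_equicontinuous gfK).
(* [K] maps onto [D]; being minimal and distal it is a factor of [D], and being equicontinuous it is
   a factor of [B]. *)
have [p [cp ep sp]] := oK mD.
have [p' [cp' ep' sp']] := uD K dK mK.
have [r [cr er sr]] := uB K eK mK.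
have [t [ct et st]] := uD B (equicontinuous_distal eB) mB.
have isoDK : gspace_iso D K.
  exact: (group_flow_iso gfK polG uM baseM mK baseK ep sp cp' ep').
(* [B] is distal, hence a factor of [D] and so of [K]. *)
have stp : range (t \o p) = [set: B].
  apply/seteqP; split=> // b _.
  have [d _ <-] : range t b by rewrite st.
  have [k _ <-] : range p d by rewrite sp.
  by exists k.
have isoBK : gspace_iso B K.
  apply: (group_flow_iso gfK polG uM baseM mK baseK _ stp cr er).
  by move=> g x; rewrite /= ep et.
have [f [hf ef]] := group_flow_coset gfK polG uM baseM mK baseK.
set H := stabilizer e in f hf ef *.
have cH : closed H by exact: stabilizer_closed.
have isoB : gspace_iso B (coset_gspace H).
  by apply: (gspace_iso_trans isoBK); apply: gspace_iso_sym; exists f.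
have coH : cocompact H.
  have [g [hg fg gf]] := homeomorphism_inv hf.
  rewrite /cocompact (_ : setT = range g); last first.
    by apply/seteqP; split=> // x _; exists (f x).
  apply: continuous_compact; last exact: flow_compact.
  by apply: continuous_subspaceT; exact: hg.1.
split.
- exact: gspace_iso_trans isoDK (gspace_iso_sym isoBK).
- by exists H.
move=> Gs cGs _ eaGs cM.
suff -> : closed_normal_closure Gs = H by [].
apply: subgroup_eq; apply/seteqP; split.
  (* An element fixing the point [k] fixes [e] and therefore all of [K], so its conjugates lie in
     [H]. *)
  have [k kP] := eaGs (restricted_flow K Gs).
  apply: closed_normal_closure_sub => // g h Gh; rewrite /H /=.
  have he : gact h e = e.
    apply: (group_flow_fix gfK (p := k)).
    exact: (kP (exist _ h (mem_set Gh))).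
  by rewrite !gactM (stabilizer_act gfK (g := h)) ?gactKV.
(* An element of [H] acts trivially on [K], hence on its factor [B] and on every minimal
   equicontinuous flow. *)
move=> h Hh; apply: contrapT => Nh.
have [Y [y [eY mY]]] := equicontinuous_flow_moving R cM eB Nh; apply.
have [w [cw ew sw]] := uB Y eY mY.
have [b _ <-] : range w y by rewrite sw.
have [k _ <-] : range (t \o p) b by rewrite stp.
by rewrite -ew /= -et -ep (stabilizer_act gfK).
Qed.
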